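(* Work in the setting of the context (problem $(\mathrm P_{t,x})$ with the basic assumptions). Assume that - $\Lambda$ is real valued and bounded on bounded subsets of $[0,T]\times\mathbb R^n\times\mathbb R^m$; - $\Lambda$ satisfies Condition (S); - $\Lambda$ is radially convex in the control variable, i.e. for a.e. $s\in[0,T]$ and every $y\in\mathbb R^n$, $u\in\mathcal U$, the map $0<r\mapsto\Lambda(s,y,ru)$ is convex. Then the Lavrentiev phenomenon for $(\mathrm P_{t,x})$ does not occur: for every $t\in[0,T[$ and $x\in\mathcal S$, the infimum of $J_t$ over all admissible pairs for $(\mathrm P_{t,x})$ equals the infimum of $J_t$ over the admissible pairs $(y,u)$ with $y$ Lipschitz and $u$ bounded.
   Context: **Problem.** $T>0$, $n,m\ge1$. For $t\in[0,T[$ and $x\in\mathcal S$, problem $(\mathrm P_{t,x})$ is to minimize $J_t(y,u):=\int_t^T\Lambda(s,y(s),u(s))\,ds+g(y(T))$ over pairs $(y,u)$ with $y\in W^{1,1}([t,T];\mathbb R^n)$, $u:[t,T]\to\mathbb R^m$ measurable, $y'(s)=b(y(s))u(s)$ for a.e. $s\in[t,T]$, $y(t)=x$, $u(s)\in\mathcal U$ for a.e. $s$, $y(s)\in\mathcal S$ for all $s\in[t,T]$. Such a pair is *admissible* if moreover $J_t(y,u)<+\infty$. It is assumed that for each $t\in[0,T[$, $x\in\mathcal S$ there is at least one admissible pair. **Basic assumptions.** $\Lambda:[0,T]\times\mathbb R^n\times\mathbb R^m\to[0,+\infty[$ is Lebesgue–Borel measurable (w.r.t. the $\sigma$-algebra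 generated by products of Lebesgue subsets of $[0,T]$ and Borel subsets of $\mathbb R^n\times\mathbb R^m$); $b$ is a Borel map from $\mathbb R^n$ to the linear maps $\mathbb R^m\to\mathbb R^n$ with $|b(y)|\le\theta(1+|y|)$ for some $\theta\ge0$; $\mathcal S\subseteq\mathbb R^n$ is nonempty; $\mathcal U\subseteq\mathbb R^m$ is a nonempty cone ($u\in\mathcal U,\lambda>0\Rightarrow\lambda u\in\mathcal U$); $g:\mathcal S\to[0,+\infty]$ is not identically $+\infty$; there are $\alpha>0$, $d\ge0$ with $\Lambda(s,y,u)\ge\alpha|u|-d$ for a.e. $s\in[0,T]$ and all $y\in\mathbb R^n,u\in\mathcal U$. **Condition (S).** There are $\kappa,A\ge0$, $\gamma\in L^1[0,T]$, $\varepsilon_*>0$ such that for a.e. $s\in[0,T]$: $|\Lambda(s_2,y,u)-\Lambda(s_1,y,u)|\le(\kappa\Lambda(s,y,u)+A|u|+\gamma(s))|s_2-s_1|$ whenever $s_1,s_2\in[s-\varepsilon_*,s+\varepsilon_*]\cap[0,T]$, $y\in\mathbb R^n$, $u\in\mathcal U$. *)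

(* Defs.v *)
From HB Require Import structures.
From mathcomp Require Export all_boot all_order all_algebra.
From mathcomp Require Export all_classical all_reals all_analysis.

Set Implicit Arguments.
Unset Strict Implicit.
Unset Printing Implicit Defensive.

Export Order.TTheory GRing.Theory Num.Theory.
Export numFieldNormedType.Exports.

Local Open Scope classical_set_scope.
Local Open Scope ring_scope.

(** Vectors of R^k are columns [ 'cV[R]_k ] with MathComp-Analysis' (supremum)
    norm.  Norms enter the problem only through bounds with existentially
    quantified constants, so the choice of the norm is immaterial. *)

(** The real line with its Lebesgue (not merely Borel) measurable sets.  As
    this type unfolds to [R], whose canonical measurable sets are the Borel
    sets, the source of [measurable_fun] is always given explicitly. *)
Notation lebesgueR R :=
  (caratheodory_type ((@wlength R idfun)^*)%mu).

Notation leb := completed_lebesgue_measure.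

(** A topological space with its Borel measurable sets. *)
Notation borelType X := (g_sigma_algebraType (@open X)).

(** [y] belongs to W^{1,1}([t,T];R^n) and has derivative [v] in L^1: [y] is
    the (absolutely continuous) primitive of [v].  Values outside [t,T] are
    irrelevant. *)
Definition W11_with_derivative (R : realType) (n : nat) (t T : R)
    (y v : R -> 'cV[R]_n) : Prop :=
  (forall i, leb.-integrable `[t, T]
     (fun s : lebesgueR R => (v s i ord0)%:E)) /\
  (forall s, s \in `[t, T] -> forall i,
     y s i ord0 = y t i ord0
       + \int[leb]_(r in (`[t, s] : set (lebesgueR R))) v r i ord0).

(** The constraints of problem (P_{t,x}). *)
Definition control_pair (R : realType) (n m : nat) (T : R)
    (b : 'cV[R]_n -> 'M[R]_(n, m)) (S : set 'cV[R]_n) (U : set 'cV[R]_m)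
    (t : R) (x : 'cV[R]_n) (y : R -> 'cV[R]_n) (u : R -> 'cV[R]_m) : Prop :=
  [/\ @measurable_fun _ _ (lebesgueR R) (borelType 'cV[R]_m) `[t, T] u,
      exists2 v, W11_with_derivative t T y v &
        {ae leb, forall s : lebesgueR R,
           s \in `[t, T] -> v s = b (y s) *m u s},
      y t = x,
      {ae leb, forall s : lebesgueR R, s \in `[t, T] -> U (u s)} &
      forall s, s \in `[t, T] -> S (y s)].

Definition cost (R : realType) (n m : nat) (T : R)
    (Lambda : R -> 'cV[R]_n -> 'cV[R]_m -> R) (g : 'cV[R]_n -> \bar R)
    (t : R) (y : R -> 'cV[R]_n) (u : R -> 'cV[R]_m) : \bar R :=
  (\int[leb]_(s in (`[t, T] : set (lebesgueR R))) (Lambda s (y s) (u s))%:E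
     + g (y T))%E.

Definition admissible (R : realType) (n m : nat) (T : R)
    (Lambda : R -> 'cV[R]_n -> 'cV[R]_m -> R)
    (b : 'cV[R]_n -> 'M[R]_(n, m)) (S : set 'cV[R]_n) (U : set 'cV[R]_m)
    (g : 'cV[R]_n -> \bar R)
    (t : R) (x : 'cV[R]_n) (y : R -> 'cV[R]_n) (u : R -> 'cV[R]_m) : Prop :=
  control_pair T b S U t x y u /\ (cost T Lambda g t y u < +oo)%E.

(** Measurability for the sigma-algebra generated by products of Lebesgue
    subsets of [0,T] and Borel subsets of R^n x R^m. *)
Definition Lebesgue_Borel_measurable (R : realType) (n m : nat) (T : R)
    (Lambda : R -> 'cV[R]_n -> 'cV[R]_m -> R) : Prop :=
  @measurable_fun _ _
    (lebesgueR R * borelType ('cV[R]_n * 'cV[R]_m)%type)%type R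
    (`[0, T] `*` setT) (fun z => Lambda z.1 z.2.1 z.2.2).

Definition Borel_map (X Y : ptopologicalType) (f : X -> Y) : Prop :=
  @measurable_fun _ _ (borelType X) (borelType Y) setT f.

(** [u |-> b y *m u] has operator norm at most theta * (1 + |y|). *)
Definition linear_growth (R : realType) (n m : nat)
    (b : 'cV[R]_n -> 'M[R]_(n, m)) : Prop :=
  exists2 theta : R, 0 <= theta &
    forall (y : 'cV[R]_n) (v : 'cV[R]_m),
      `|b y *m v| <= theta * (1 + `|y|) * `|v|.

Definition cone (R : realType) (m : nat) (U : set 'cV[R]_m) : Prop :=
  forall u (lambda : R), U u -> 0 < lambda -> U (lambda *: u).

Definition coercive (R : realType) (n m : nat) (T : R)
    (Lambda : R -> 'cV[R]_n -> 'cV[R]_m -> R) (U : set 'cV[R]_m) : Prop :=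
  exists alpha d : R, [/\ 0 < alpha, 0 <= d &
    {ae leb, forall s : lebesgueR R, s \in `[0, T] ->
       forall y u, U u -> alpha * `|u| - d <= Lambda s y u}].

Definition condition_S (R : realType) (n m : nat) (T : R)
    (Lambda : R -> 'cV[R]_n -> 'cV[R]_m -> R) (U : set 'cV[R]_m) : Prop :=
  exists (kappa A : R) (gamma : R -> R) (eps : R),
    [/\ 0 <= kappa, 0 <= A,
        leb.-integrable `[0, T] (fun s : lebesgueR R => (gamma s)%:E),
        0 < eps &
        {ae leb, forall s : lebesgueR R, s \in `[0, T] ->
           forall s1 s2 : R,
             s1 \in `[s - eps, s + eps] -> s1 \in `[0, T] ->
             s2 \in `[s - eps, s + eps] -> s2 \in `[0, T] ->
           forall y u, U u ->
             `|Lambda s2 y u - Lambda s1 y u|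
               <= (kappa * Lambda s y u + A * `|u| + gamma s)
                    * `|s2 - s1|}].

Definition bounded_on_bounded_sets (R : realType) (n m : nat) (T : R)
    (Lambda : R -> 'cV[R]_n -> 'cV[R]_m -> R) : Prop :=
  forall B : set (R * ('cV[R]_n * 'cV[R]_m)),
    bounded_set B -> B `<=` `[0, T] `*` setT ->
    [bounded Lambda z.1 z.2.1 z.2.2 | z in B].

Definition radially_convex (R : realType) (n m : nat) (T : R)
    (Lambda : R -> 'cV[R]_n -> 'cV[R]_m -> R) (U : set 'cV[R]_m) : Prop :=
  {ae leb, forall s : lebesgueR R, s \in `[0, T] -> forall y u, U u ->
     convex_function (`]0, +oo[ : set (convex_lmodType R^o))
       (fun r => Lambda s y (r *: u))}.

(* Main.v *)
(** Starting from an admissible pair [(y, u)], change time so that the control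
    becomes bounded: let [phi] be the increasing bijection of [[t, T]] whose
    derivative is [p = max(1, |u|/nu) - eps 1_Sigma], where [Sigma] is a set of
    positive measure on which [|u| <= c], and [eps] makes the mean of [p] equal
    to 1.  With [psi] the inverse of [phi], the pair [(y o psi, (u / p) o psi)]
    has the same end points and the same range, and its control is bounded by
    [2 nu].  Substituting [phi], its cost is the integral of
    [Lambda(phi, y, u/p) p].  As [|phi - id|] is [O(1/nu)], Condition (S),
    applied at the point [phi(tau)], replaces [Lambda(phi, ., .)] by
    [Lambda(tau, ., .)].  Where [|u| > nu], radial convexity at the points of
    norm [1 < nu < |u|] gives
    [Lambda(tau, y, u/p) p <= Lambda(tau, y, u) + 2 M |u| / nu], where [M]
    bounds [Lambda] on a fixed bounded set; on [Sigma] convexity costs at most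
    [M eps].  All the errors are [O(1/nu)]. *)
From HB Require Import structures.
Require Import Defs.
From mathcomp Require Import measurable_realfun ring lra.

Set Implicit Arguments.
Unset Strict Implicit.
Unset Printing Implicit Defensive.

Local Open Scope classical_set_scope.
Local Open Scope ring_scope.

(** * Measures with a density *)

(** Countable additivity is that of the integral of a nonnegative function over disjoint sets. *)
Lemma density_measure d (T : measurableType d) (R : realType)
    (mu : {measure set T -> \bar R}) (p : T -> R) :
  measurable_fun setT p -> (forall x, 0 <= p x) ->
  exists nu : {measure set T -> \bar R},
    forall A, nu A = (\int[mu]_(x in A) (p x)%:E)%E.
Proof.
move=> mp p0; pose nu A := (\int[mu]_(x in A) (p x)%:E)%E.
have nu0 : nu set0 = 0%E by rewrite /nu integral_set0.
have nu_ge0 A : (0 <= nu A)%E by apply: integral_ge0 => x _; rewrite lee_fin.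
have nu_sa : semi_sigma_additive nu.
  move=> F mF tF mUF; rewrite /nu ge0_integral_bigcup//.
    by apply: is_cvg_nneseries => k _ _; exact: nu_ge0.
  - exact/measurable_EFinP/measurable_funTS.
  - by move=> x _; rewrite lee_fin.
pose nuM := isMeasure.Build _ _ _ nu nu0 nu_ge0 nu_sa.
by exists (HB.pack_for {measure set T -> \bar R} nu nuM).
Qed.

Import HBNNSimple.

(** By monotone convergence both sides are limits along an increasing sequence of simple functions.
    For a simple function the identity reduces to its level sets, where it is the formula for
    [nu]. *)
Lemma ge0_integral_density d (T : measurableType d) (R : realType)
    (mu nu : {measure set T -> \bar R}) (p : T -> R) (f : T -> \bar R) (D : set T) :
  measurable_fun setT p -> (forall x, 0 <= p x) ->
  (forall A, measurable A -> nu A = (\int[mu]_(x in A) (p x)%:E)%E) ->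
  measurable D -> measurable_fun D f -> (forall x, D x -> (0 <= f x)%E) ->
  (\int[nu]_(x in D) f x = \int[mu]_(x in D) (f x * (p x)%:E))%E.
Proof.
move=> mp p0 nuE mD mf f0.
have mpD A : measurable_fun A (EFin \o p).
  exact/measurable_EFinP/measurable_funTS.
pose f_ := nnsfun_approx mD mf.
transitivity (limn (fun n => \int[nu]_(x in D) (f_ n x)%:E)%E).
  rewrite -monotone_convergence//.
  - apply: eq_integral => y /[!inE] yD; apply/esym/cvg_lim => //.
    exact: cvg_nnsfun_approx.
  - by move=> n; exact/measurable_EFinP/measurable_funP.
  - by move=> n y _; rewrite lee_fin.
  - by move=> y _ m n mn; rewrite lee_fin; exact/lefP/nd_nnsfun_approx.
have -> : (fun n => \int[nu]_(x in D) (f_ n x)%:E)%E =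
          (fun n => \int[mu]_(x in D) ((f_ n x)%:E * (p x)%:E))%E.
  apply/funext => n.
  have mfn r : measurable (f_ n @^-1` [set r]).
    by rewrite -[X in measurable X]setTI; exact: measurable_funP.
  have ind_ge0 r x : (0 <= (r * \1_(f_ n @^-1` [set r]) x)%:E)%E.
    by rewrite EFinM nnfun_muleindic_ge0.
  transitivity (\sum_(k \in range (f_ n))
      \int[nu]_(x in D) (k * \1_(f_ n @^-1` [set k]) x)%:E)%E.
    under eq_integral do rewrite fimfunE -fsumEFin//.
    rewrite ge0_integral_fsum//.
    by move=> y; exact/measurable_EFinP/measurable_funM.
  transitivity (\sum_(k \in range (f_ n))
      \int[mu]_(x in D) ((k * \1_(f_ n @^-1` [set k]) x)%:E * (p x)%:E))%E; last first.
    rewrite -ge0_integral_fsum//.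
    - apply: eq_integral => x _; rewrite [in RHS]fimfunE -fsumEFin//.
      by rewrite ge0_mule_fsuml.
    - move=> y; apply: emeasurable_funM => //.
      exact/measurable_EFinP/measurable_funM.
    - by move=> y x _; rewrite mule_ge0// lee_fin.
  apply: eq_fsbigr => r _; rewrite integralZl_indic_nnsfun// integral_indic//=.
  rewrite nuE; last exact: measurableI.
  (* A negative [r] is not a value of the nonnegative [f_ n], so its level set is empty. *)
  have [r0|r0] := ltP r 0.
    have -> : f_ n @^-1` [set r] = set0.
      apply/seteqP; split => // x /= fx; move: r0; rewrite -fx.
      by rewrite ltNge fun_ge0.
    rewrite set0I integral_set0 mule0 integral0_eq// => x _.
    by rewrite indic0 mulr0 mul0e.
  transitivity (\int[mu]_(x in D)
      (r%:E * ((\1_(f_ n @^-1` [set r]) x)%:E * (p x)%:E)))%E; last first.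
    by apply: eq_integral => x _; rewrite muleA -EFinM.
  rewrite ge0_integralZl//; last 2 first.
  - apply: emeasurable_funM => //; exact/measurable_EFinP/measurable_indic.
  - by move=> x _; rewrite mule_ge0// lee_fin.
  congr (_ * _)%E.
  rewrite setIC integral_mkcondr; apply: eq_integral => x _.
  by rewrite epatch_indic muleC.
rewrite -monotone_convergence//.
- apply: eq_integral => x /[!inE] Dx; apply/cvg_lim => //.
  by apply: cvgeZr => //; exact: cvg_nnsfun_approx.
- move=> n; apply: emeasurable_funM => //.
  exact/measurable_EFinP/measurable_funP.
- by move=> n x _; rewrite mule_ge0// lee_fin.
- move=> x _ m n mn; apply: lee_wpmul2r; first by rewrite lee_fin.
  by rewrite lee_fin; exact/lefP/nd_nnsfun_approx.
Qed.

(** * Change of variables for the Lebesgue measure *)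

Lemma borel_lebesgue_measurable (R : realType) (A : set R) :
  measurable A -> measurable (A : set (lebesgueR R)).
Proof. exact: sub_caratheodory. Qed.

Lemma measurable_fun_lebesgueR (R : realType) d (T : measurableType d)
    (f : R -> T) :
  measurable_fun setT f ->
  @measurable_fun _ _ (lebesgueR R) T setT f.
Proof.
move=> mf _ Y mY; apply: borel_lebesgue_measurable; exact: mf.
Qed.

Lemma leb_borel (R : realType) (A : set R) : leb A = lebesgue_measure A.
Proof. by []. Qed.

(** Lebesgue measurable sets form the completion of the Borel sets: [E] is a Borel set together with
    part of a Borel null set. Facts about Lebesgue sets thus reduce to Borel ones. *)
Lemma borel_approx (R : realType) (E : set (lebesgueR R)) :
  measurable E -> exists A B : set R, [/\ measurable A, measurable B,
    A `<=` E, E `<=` A `|` B & leb B = 0%E].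
Proof.
move=> mE.
have : (completed_algebra_gen (@lebesgue_measure R)).-sigma.-measurable E.
  by rewrite completed_caratheodory_measurable.
rewrite g_sigma_completed_algebra_genE.
move=> [A /= mA [N [B [mB B0 NB]] <-]].
by exists A, B; split => //; exact: setUS.
Qed.

Lemma leb_null_measurable (R : realType) (N : set (lebesgueR R)) (B : set R) :
  measurable B -> leb B = 0%E -> N `<=` B -> measurable N.
Proof.
move=> mB B0 NB; apply: negligible_sub_caratheodory.
by exists B; split => //; exact: sub_caratheodory.
Qed.

Section change_of_variables.
Variables (R : realType) (phi psi : R -> R) (p : lebesgueR R -> R).
Hypotheses (phiK : cancel phi psi) (psiK : cancel psi phi).
Hypothesis phi_mono : {mono phi : x y / x <= y}.
Hypotheses (mp : measurable_fun setT p) (p_gt0 : forall x, 0 < p x).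
Hypothesis phi_primitive : forall a b : R, a <= b ->
  (\int[leb]_(x in (`]a, b] : set (lebesgueR R))) (p x)%:E =
   (phi b - phi a)%:E)%E.

Let p_ge0 x : 0 <= p x. Proof. exact: ltW. Qed.

Let psi_mono : {mono psi : x y / x <= y}.
Proof. by move=> x y; rewrite -{2}(psiK x) -{2}(psiK y) phi_mono. Qed.

Lemma preimage_phi_itvoc a b : phi @^-1` `]a, b] = `]psi a, psi b]%classic.
Proof.
apply/seteqP; split => x /=; rewrite !in_itv/=.
  by rewrite -[x in X in _ -> X]phiK !(leW_mono psi_mono) psi_mono.
by rewrite -[x in X in X -> _]phiK !(leW_mono psi_mono) psi_mono.
Qed.

Lemma preimage_phi_itvcc a b : phi @^-1` `[a, b] = `[psi a, psi b]%classic.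
Proof.
apply/seteqP; split => x /=; rewrite !in_itv/=.
  by rewrite -[x in X in _ -> X]phiK !psi_mono.
by rewrite -[x in X in X -> _]phiK !psi_mono.
Qed.

Lemma borel_phi : measurable_fun (setT : set R) phi.
Proof.
by apply: nondecreasing_measurable => // x y; rewrite phi_mono.
Qed.

Lemma borel_psi : measurable_fun (setT : set R) psi.
Proof.
by apply: nondecreasing_measurable => // x y; rewrite psi_mono.
Qed.

(** The push-forward under [phi] of the measure with density [p] agrees with Lebesgue measure on
    half-open intervals, hence on all Borel sets. *)
Lemma leb_phi_borel (A : set R) : measurable A ->
  leb A = (\int[leb]_(x in (phi @^-1` A : set (lebesgueR R))) (p x)%:E)%E.
Proof.
move=> mA; have [nu nuE] := @density_measure _ _ _ leb p mp p_ge0.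
have mphi := measurable_fun_lebesgueR borel_phi.
pose nuphi' : {measure set (measurableTypeR R) -> \bar R} :=
  [the measure _ _ of pushforward nu (phi : lebesgueR R -> measurableTypeR R)].
pose nuphi := nuphi' mphi.
rewrite leb_borel (@lebesgue_measure_unique _ nuphi) ?[LHS]nuE// => X.
move/ocitvP => [->|[[a b]/= ab ->]]; first by rewrite !measure0.
rewrite [RHS]nuE preimage_phi_itvoc phi_primitive ?psi_mono 1?ltW// !psiK.
by rewrite lebesgue_measure_itv/= lte_fin ab -EFinB.
Qed.

(* [p > 0] is what makes null sets pull back to null sets. *)
Lemma leb_null_phi_borel (B : set R) : measurable B -> leb B = 0%E ->
  leb (phi @^-1` B) = 0%E.
Proof.
move=> mB B0.
have mD : measurable (phi @^-1` B : set (lebesgueR R)).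
  by apply: borel_lebesgue_measurable; rewrite -[X in measurable X]setTI;
     exact: borel_phi.
have mpD : measurable_fun (phi @^-1` B : set (lebesgueR R)) (EFin \o p).
  exact/measurable_EFinP/measurable_funTS.
have [+ _] := @ae_eq_integral_abs _ _ _ leb _ mD (EFin \o p) mpD.
have -> : (\int[leb]_(x in (phi @^-1` B : set (lebesgueR R)))
    `|(EFin \o p) x| = 0)%E.
  rewrite -B0 leb_phi_borel//; apply: eq_integral => x _ /=.
  by rewrite ger0_norm.
move=> /(_ erefl) [N [mN N0 sN]]; apply: (subset_measure0 _ mN _ N0) => //.
move=> x Dx; apply: sN => /= /(_ Dx) /eqP; rewrite eqe => /eqP p0.
by have := p_gt0 x; rewrite p0 ltxx.
Qed.

(** By [leb_phi_borel], the measure of the preimage is the integral of [p] over [B] itself. *)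
Lemma leb_null_psi_borel (B : set R) : measurable B -> leb B = 0%E ->
  leb (psi @^-1` B) = 0%E.
Proof.
move=> mB B0; rewrite leb_phi_borel; last first.
  by rewrite -[X in measurable X]setTI; exact: borel_psi.
rewrite (_ : phi @^-1` (psi @^-1` B) = B); last first.
  by apply/seteqP; split => x /=; rewrite phiK.
apply: (null_set_integral (borel_lebesgue_measurable mB) _ B0).
exact/measurable_EFinP/measurable_funTS.
Qed.

(** A Lebesgue set is Borel only up to a null set, so Borel measurability of [f] must be
    supplemented by null preimages of null sets. *)
Let lebesgue_preimage (f : R -> R) : measurable_fun setT f ->
  (forall B : set R, measurable B -> leb B = 0%E -> leb (f @^-1` B) = 0%E) ->
  @measurable_fun _ _ (lebesgueR R) (lebesgueR R) setT f.
Proof.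
move=> mf f0 _ E mE; rewrite setTI.
have [A [B [mA mB AE EAB B0]]] := borel_approx mE.
have mfB C : measurable C -> measurable (f @^-1` C : set R).
  by move=> mC; rewrite -[X in measurable X]setTI; exact: mf.
rewrite (_ : f @^-1` E = f @^-1` A `|` (f @^-1` E `\` f @^-1` A)); last first.
  apply/seteqP; split => x /=.
    by move=> Ex; have [Ax|Ax] := pselect (A (f x)); [left|right].
  by move=> [/AE//|[]].
have lmA : measurable (f @^-1` A : set (lebesgueR R)).
  by apply: borel_lebesgue_measurable; exact: mfB.
apply: measurableU => //.
apply: (@leb_null_measurable _ _ (f @^-1` B)); [exact: mfB|exact: f0|].
by move=> x /= [/EAB[|//]].
Qed.

Lemma lebesgue_measurable_phi :
  @measurable_fun _ _ (lebesgueR R) (lebesgueR R) setT phi.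
Proof. exact: lebesgue_preimage borel_phi leb_null_phi_borel. Qed.

Lemma lebesgue_measurable_psi :
  @measurable_fun _ _ (lebesgueR R) (lebesgueR R) setT psi.
Proof. exact: lebesgue_preimage borel_psi leb_null_psi_borel. Qed.

(** [E] lies between two Borel sets of equal measure, to which the Borel case applies; monotonicity
    gives both inequalities. *)
Lemma leb_phi (E : set (lebesgueR R)) : measurable E ->
  leb E = (\int[leb]_(x in (phi @^-1` E : set (lebesgueR R))) (p x)%:E)%E.
Proof.
move=> mE; have [A [B [mA mB AE EAB B0]]] := borel_approx mE.
have mAB : measurable (A `|` B) by exact: measurableU.
have mphi (C : set (lebesgueR R)) :
    measurable C -> measurable (phi @^-1` C : set (lebesgueR R)).
  by move=> mC; rewrite -[X in measurable X]setTI;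
     exact: lebesgue_measurable_phi.
have lmA := borel_lebesgue_measurable mA.
have lmAB := borel_lebesgue_measurable mAB.
have mpD C : measurable_fun (C : set (lebesgueR R)) (EFin \o p).
  exact/measurable_EFinP/measurable_funTS.
have lebAB : leb (A `|` B) = leb A.
  apply: measureU0 => //; exact: borel_lebesgue_measurable.
apply/eqP; rewrite eq_le; apply/andP; split.
  apply: (@le_trans _ _ (leb (A `|` B))).
    by apply: le_measure => //; rewrite inE.
  rewrite lebAB leb_phi_borel//; apply: ge0_subset_integral => //.
  - exact: mphi.
  - exact: mphi.
  - by move=> x _; rewrite lee_fin.
  - by move=> x /AE.
apply: (@le_trans _ _ (leb (A `|` B))).
  rewrite leb_phi_borel//; apply: ge0_subset_integral => //.
  - exact: mphi.
  - exact: mphi.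
  - by move=> x _; rewrite lee_fin.
  - by move=> x /EAB.
by rewrite lebAB; apply: le_measure => //; rewrite inE.
Qed.

(** Lebesgue measure is the push-forward under [phi] of the measure with density [p]; the
    push-forward and the density are then unfolded in turn. *)
Lemma ge0_integral_change (D : set (lebesgueR R)) (F : lebesgueR R -> \bar R) :
  measurable D -> measurable_fun D F -> (forall x, D x -> (0 <= F x)%E) ->
  (\int[leb]_(x in D) F x =
   \int[leb]_(x in (phi @^-1` D : set (lebesgueR R))) (F (phi x) * (p x)%:E))%E.
Proof.
move=> mD mF F0; have [nu nuE] := @density_measure _ _ _ leb p mp p_ge0.
have mphi := lebesgue_measurable_phi.
have mpreD : measurable (phi @^-1` D : set (lebesgueR R)).
  by rewrite -[X in measurable X]setTI; exact: mphi.
rewrite (eq_measure_integral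
  (pushforward nu (phi : lebesgueR R -> lebesgueR R))); last first.
  move=> A mA _; rewrite [RHS]nuE. exact: leb_phi.
rewrite ge0_integral_pushforward//; last by move=> y /[!inE]; exact: F0.
rewrite (@ge0_integral_density _ _ _ leb nu p)//.
- apply: (measurable_comp mD) => //; last exact: measurable_funTS.
  by move=> _ [x Dx <-].
- by move=> x Dx; exact: F0.
Qed.

Lemma integral_change (D : set (lebesgueR R)) (F : lebesgueR R -> \bar R) :
  measurable D -> measurable_fun D F ->
  (\int[leb]_(x in D) F x =
   \int[leb]_(x in (phi @^-1` D : set (lebesgueR R))) (F (phi x) * (p x)%:E))%E.
Proof.
move=> mD mF; rewrite integralE [RHS]integralE.
rewrite (ge0_integral_change mD (measurable_funepos mF))//.
rewrite (ge0_integral_change mD (measurable_funeneg mF))//.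
congr (_ - _)%E; apply: eq_integral => x _.
- by rewrite !funeposE maxe_pMl ?mul0e// lee_fin.
- by rewrite !funenegE maxe_pMl ?mul0e ?lee_fin// mulNe.
Qed.

(** The exceptional set is enclosed in a Borel null set, whose preimage is again null. *)
Let ae_preimage (f : R -> R) : measurable_fun (setT : set R) f ->
  (forall B : set R, measurable B -> leb B = 0%E -> leb (f @^-1` B) = 0%E) ->
  forall P : R -> Prop, {ae leb, forall s : lebesgueR R, P s} ->
  {ae leb, forall s : lebesgueR R, P (f s)}.
Proof.
move=> mf f0 P [N [mN N0 PN]].
have [A [B [mA mB AN NAB B0]]] := borel_approx mN.
have mAB : measurable (A `|` B) by exact: measurableU.
have lA := borel_lebesgue_measurable mA; have lB := borel_lebesgue_measurable mB.
exists (f @^-1` (A `|` B)); split.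
- by apply: borel_lebesgue_measurable; rewrite -[X in measurable X]setTI;
    exact: mf.
- by apply: f0 => //; rewrite measureU0//; exact: (subset_measure0 lA mN AN N0).
- by move=> x /= Px; apply: NAB; apply: PN.
Qed.

Lemma ae_phi (P : R -> Prop) : {ae leb, forall s : lebesgueR R, P s} ->
  {ae leb, forall s : lebesgueR R, P (phi s)}.
Proof. exact: ae_preimage borel_phi leb_null_phi_borel P. Qed.

Lemma ae_psi (P : R -> Prop) : {ae leb, forall s : lebesgueR R, P s} ->
  {ae leb, forall s : lebesgueR R, P (psi s)}.
Proof. exact: ae_preimage borel_psi leb_null_psi_borel P. Qed.

End change_of_variables.

(** * Measurability of vector-valued maps *)

Lemma measurable_fun_borel d (T : measurableType d) (X : ptopologicalType)
    (D : set T) (f : T -> X) :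
  (forall O, open O -> measurable (D `&` f @^-1` O)) ->
  @measurable_fun _ _ T (borelType X) D f.
Proof.
move=> mf; apply: (@measurability _ _ T (borelType X) D f (@open X)) => //.
by move=> _ [A oA <-]; exact: mf.
Qed.

Lemma borel_continuous (R : realType) (X : ptopologicalType) (f : X -> R) :
  continuous f -> @measurable_fun _ _ (borelType X) R setT f.
Proof.
move=> /continuousP cf.
apply: (measurability _ (RGenOInfty.measurableE R)) => /=.
move=> _ [_ [x ->] <-]; rewrite setTI; apply: sub_sigma_algebra.
by apply: cf; exact: interval_open.
Qed.

(** In a separable normed space an open set is the countable union of the balls it contains that
    have their centre in a dense countable family and radius [1/(k+1)]. Hence balls suffice as test
    sets. *)
Lemma measurable_fun_dense d (T : measurableType d) (R : realType)
    (X : normedModType R) (I : countType) (c : I -> X) (D : set T)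
    (f : T -> X) :
  (forall x (e : R), 0 < e -> exists i, ball (c i) e x) ->
  (forall i (e : R), 0 < e -> measurable (D `&` f @^-1` ball (c i) e)) ->
  @measurable_fun _ _ T (borelType X) D f.
Proof.
move=> dense mf; apply: measurable_fun_borel => O oO.
pose B (k : I * nat) := ball (c k.1) (k.2.+1%:R^-1 : R).
pose J := [set k | B k `<=` O].
have -> : D `&` f @^-1` O = \bigcup_(k in J) (D `&` f @^-1` B k).
  apply/seteqP; split => [x [Dx Ofx]|x [k kO [Dx Bx]]]; last first.
    by split => //; exact: kO.
  have /nbhs_ballP[e /= e0 eO] : nbhs (f x) O by exact: open_nbhs_nbhs.
  (* Half of [e] is taken because a ball containing [f x] reaches at most twice its radius away from
     [f x]. *)
  have /ltr_add_invr [n nE] : 0 < e / 2 by rewrite divr_gt0.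
  rewrite add0r in nE.
  have n0 : 0 < n.+1%:R^-1 :> R by rewrite invr_gt0.
  have [i ci] := dense (f x) _ n0.
  exists (i, n) => // y ciy; apply: eO.
  apply: (@le_ball _ _ _ (n.+1%:R^-1 + n.+1%:R^-1)).
    by rewrite (splitr e) lerD// ltW.
  exact: ball_triangle (ball_sym ci) ciy.
rewrite bigcup_mkcond; apply: countable_bigcupT_measurable => // k.
by case: ifP => // _; apply: mf; rewrite invr_gt0.
Qed.

Lemma dense_rat_cV (R : realType) k (x : 'cV[R]_k) (e : R) : 0 < e ->
  exists q : 'cV[rat]_k, ball (map_mx (@ratr R) q) e x.
Proof.
move=> e0.
have h i : exists q : rat, ball (ratr q : R) e (x i ord0).
  have [q /= qx] : exists q : rat, ratr q \in `]x i ord0 - e, x i ord0 + e[.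
    by apply: rat_in_itvoo; rewrite ltrBlDr -addrA ltrDl addr_gt0.
  exists q; move: qx; rewrite in_itv/= => qx; rewrite /ball/= distrC.
  by rewrite ltr_norml; lra.
have [q qP] := choice h.
exists (\col_i q i); split=> // i j; rewrite !mxE (ord1 j); exact: qP.
Qed.

(** A ball of the supremum norm is cut out by one condition on each coordinate, and rational centres
    are dense. *)
Lemma measurable_fun_cV d (T : measurableType d) (R : realType) k
    (D : set T) (f : T -> 'cV[R]_k) : measurable D ->
  (forall i, measurable_fun D (fun x => f x i ord0)) ->
  @measurable_fun _ _ T (borelType 'cV[R]_k) D f.
Proof.
move=> mD mf.
apply: (@measurable_fun_dense _ _ _ 'cV[R]_k _ (map_mx (@ratr R))).
  exact: dense_rat_cV.
move=> q e e0.
have -> : D `&` f @^-1` ball (map_mx (@ratr R) q) e =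
    D `&` \bigcap_(i : 'I_k) (D `&` (fun x => f x i ord0) @^-1` ball (ratr (q i ord0) : R) e).
  apply/seteqP; split => [x [Dx fx]|x [Dx fx]]; split => //.
    by move=> i _; split => //=; have := fx.2 i ord0; rewrite mxE.
  by split=> // i j; rewrite (ord1 j) mxE; exact: (fx i I).2.
apply: measurableI => //; apply: fin_bigcap_measurable => // i _.
by apply: mf => //; apply: open_measurable; exact: ball_open.
Qed.

Lemma measurable_fun_cV_coord d (T : measurableType d) (R : realType) k
    (D : set T) (f : T -> 'cV[R]_k) i :
  @measurable_fun _ _ T (borelType 'cV[R]_k) D f ->
  measurable_fun D (fun x => f x i ord0).
Proof.
move=> mf; apply: (@measurableT_comp _ _ _ _ (borelType 'cV[R]_k) _
  (fun v : 'cV[R]_k => v i ord0)) => //.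
apply: borel_continuous; exact: coord_continuous.
Qed.

Lemma measurable_fun_cV_norm d (T : measurableType d) (R : realType) k
    (D : set T) (f : T -> 'cV[R]_k) :
  @measurable_fun _ _ T (borelType 'cV[R]_k) D f ->
  measurable_fun D (fun x => `|f x|).
Proof.
move=> mf; apply: (@measurableT_comp _ _ _ _ (borelType 'cV[R]_k) _
  (fun v : 'cV[R]_k => `|v|)) => //.
apply: borel_continuous; exact: norm_continuous.
Qed.

(** Measurability of [Lambda] refers to the Borel sets of the product topology. A ball of the
    product is a product of balls, so pairs of rational centres suffice. *)
Lemma measurable_fun_cV_pair d (T : measurableType d) (R : realType) k l
    (D : set T) (f : T -> 'cV[R]_k) (g : T -> 'cV[R]_l) : measurable D ->
  @measurable_fun _ _ T (borelType 'cV[R]_k) D f ->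
  @measurable_fun _ _ T (borelType 'cV[R]_l) D g ->
  @measurable_fun _ _ T (borelType ('cV[R]_k * 'cV[R]_l)%type) D
    (fun x => (f x, g x)).
Proof.
move=> mD mf mg.
apply: (@measurable_fun_dense _ _ R ('cV[R]_k * 'cV[R]_l)%type _
  (fun q : 'cV[rat]_k * 'cV[rat]_l =>
     (map_mx (@ratr R) q.1, map_mx (@ratr R) q.2))).
  move=> x e e0; have [q1 h1] := dense_rat_cV x.1 e0.
  by have [q2 h2] := dense_rat_cV x.2 e0; exists (q1, q2).
move=> q e e0.
rewrite (_ : _ `&` _ = (D `&` f @^-1` ball (map_mx (@ratr R) q.1) e) `&`
  (D `&` g @^-1` ball (map_mx (@ratr R) q.2) e)); last first.
  by apply/seteqP; split => [x [Dx []]|x [[Dx] ? []]].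
apply: measurableI; [apply: mf|apply: mg] => //; apply: sub_sigma_algebra;
  exact: ball_open.
Qed.

(** * Time changes with a prescribed derivative *)

Lemma lebesgue_measurable_itv (R : realType) (i : interval R) :
  measurable ([set` i] : set (lebesgueR R)).
Proof. by apply: borel_lebesgue_measurable; exact: measurable_itv. Qed.

Lemma integrable_cst d (T : measurableType d) (R : realType)
    (mu : {measure set T -> \bar R}) (D : set T) (r : R) :
  measurable D -> (mu D < +oo)%E -> mu.-integrable D (EFin \o cst r).
Proof.
move=> mD Doo; apply/integrableP; split; first exact/measurable_EFinP.
have -> : (\int[mu]_(x in D) `|(EFin \o cst r) x| = `|r|%:E * mu D)%E.
  by rewrite -integral_cst.
by rewrite lte_mul_pinfty// lee_fin.
Qed.

Lemma leb_itvoc (R : realType) (a b : R) : a <= b ->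
  leb (`]a, b]%classic : set (lebesgueR R)) = (b - a)%:E.
Proof.
move=> ab; rewrite leb_borel lebesgue_measure_itv/= lte_fin -EFinB.
by move: ab; rewrite le_eqVlt => /orP[/eqP->|->//]; rewrite ltxx subrr.
Qed.

(** Basing the primitive at minus infinity defines it on the whole line, whatever the order of the
    end points. *)
Definition ray_integral (R : realType) (f : lebesgueR R -> R) (x : R) : R :=
  \int[leb]_(r in (`]-oo, x] : set (lebesgueR R))) f r.

Lemma ray_integralB (R : realType) (f : lebesgueR R -> R) (a b : R) :
  leb.-integrable setT (EFin \o f) -> a <= b ->
  ray_integral f b - ray_integral f a =
    \int[leb]_(r in (`]a, b] : set (lebesgueR R))) f r.
Proof.
move=> fi ab; rewrite /ray_integral.
have -> : `]-oo, b]%classic =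
    (`]-oo, a]%classic `|` `]a, b]%classic : set (lebesgueR R)).
  by rewrite -itv_bndbnd_setU.
rewrite Rintegral_setU//.
- by rewrite addrAC subrr add0r.
- exact: lebesgue_measurable_itv.
- exact: lebesgue_measurable_itv.
- apply: integrableS fi => //.
  by apply: measurableU; exact: lebesgue_measurable_itv.
- apply/disj_set2P; apply/seteqP; split => // x /= [].
  by rewrite !in_itv/= => xa /andP[+ _]; rewrite ltNge xa.
Qed.

(** This is absolute continuity of the integral: sets of small measure carry a small integral of
    [|f|]. *)
Lemma ray_integral_continuous (R : realType) (f : lebesgueR R -> R) :
  leb.-integrable setT (EFin \o f) -> continuous (ray_integral f).
Proof.
move=> fi x; apply/cvgrPdist_le => /= e e0.
have [d [d0 fd]] := integral_normr_continuous fi e0.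
have key a b : a <= b -> b - a < d ->
    `|ray_integral f b - ray_integral f a| <= e.
  move=> ab bad; rewrite ray_integralB//.
  have mab : measurable (`]a, b] : set (lebesgueR R)).
    exact: lebesgue_measurable_itv.
  apply: (le_trans (le_normr_Rintegral mab _)).
    exact: integrableS fi.
  by apply/ltW/fd => //; rewrite [ltLHS]leb_itvoc// lte_fin.
near=> z; have [xz|/ltW zx] := leP x z.
  rewrite distrC key//.
  have : `|x - z| < d by near: z; exists d.
  by rewrite distrC ger0_norm ?subr_ge0.
rewrite key//.
have : `|x - z| < d by near: z; exists d.
by rewrite ger0_norm ?subr_ge0.
Unshelve. all: by end_near. Qed.

(** The map is [phi x = x + ray_integral q x]. As [1 + q >= 1/2], its increments are at least half
    those of the identity, which makes it an increasing bijection. It fixes [t] and [T] because [q]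
    vanishes off [[t, T]] and has integral zero. *)
Lemma reparametrization (R : realType) (t T : R) (q : lebesgueR R -> R) :
  leb.-integrable setT (EFin \o q) ->
  (forall x, - 2^-1 <= q x) ->
  (forall x : R, x \notin `[t, T] -> q x = 0) ->
  t <= T -> \int[leb]_x q x = 0 ->
  exists phi psi : R -> R,
    [/\ cancel phi psi, cancel psi phi, {mono phi : x y / x <= y},
        (forall a b : R, a <= b ->
        (\int[leb]_(x in (`]a, b] : set (lebesgueR R))) (1 + q x)%:E =
          (phi b - phi a)%:E)%E) &
        [/\ phi t = t, phi T = T &
            forall x, `|phi x - x| <= \int[leb]_x `|q x|]].
Proof.
move=> qi q_ge q0 tT q_int.
pose phi x := x + ray_integral q x.
have fin_itv (a b : R) : (leb (`]a, b] : set (lebesgueR R)) < +oo)%E.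
  have [ab|/ltW ba] := leP a b; first by rewrite [ltLHS]leb_itvoc// ltry.
  rewrite (_ : `]a, b]%classic = set0) ?measure0//.
  by apply: set_itv_ge; rewrite bnd_simp -leNgt.
have mitv (i : interval R) := lebesgue_measurable_itv i.
have c1 (a b : R) : leb.-integrable (`]a, b] : set (lebesgueR R)) (EFin \o cst 1).
  apply: integrable_cst; [exact: mitv|exact: fin_itv].
have qab (a b : R) : leb.-integrable (`]a, b] : set (lebesgueR R)) (EFin \o q).
  exact: integrableS qi.
have cq (a b : R) : leb.-integrable (`]a, b] : set (lebesgueR R))
    (EFin \o (fun x => 1 + q x)).
  exact: (integrableD (mitv _) (c1 a b) (qab a b)).
have I1 (a b : R) : a <= b ->
    \int[leb]_(x in (`]a, b] : set (lebesgueR R))) 1 = b - a.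
  move=> ab; rewrite Rintegral_cst// mul1r.
  by rewrite [X in fine X]leb_itvoc.
have phiB (a b : R) : a <= b -> phi b - phi a =
    \int[leb]_(x in (`]a, b] : set (lebesgueR R))) (1 + q x).
  move=> ab; rewrite RintegralD// I1// -ray_integralB//.
  by rewrite /phi; ring.
have phi_prim (a b : R) : a <= b ->
    (\int[leb]_(x in (`]a, b] : set (lebesgueR R))) (1 + q x)%:E =
          (phi b - phi a)%:E)%E.
  move=> ab; rewrite phiB// /Rintegral fineK//; apply: integrable_fin_num.
  - exact: mitv.
  - exact: cq.
have phi_half a b : a <= b -> (b - a) / 2 <= phi b - phi a.
  move=> ab; rewrite phiB//.
  have -> : (b - a) / 2 = \int[leb]_(x in (`]a, b] : set (lebesgueR R))) 2^-1.
    rewrite Rintegral_cst// mulrC; congr (_ * _).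
    by rewrite -I1// Rintegral_cst// mul1r.
  apply: le_Rintegral => //.
  - by apply: integrable_cst; [exact: mitv|exact: fin_itv].
  - by move=> x _; have := q_ge x; move: (q x) => r; clear; lra.
have phi_lt : {homo phi : x y / x < y}.
  move=> x y xy; have := phi_half _ _ (ltW xy).
  by move: (phi x) (phi y) xy => a1 a2; clear; lra.
have phi_mono : {mono phi : x y / x <= y} by exact: le_mono.
have phi_cont : continuous phi.
  by move=> x; apply: cvgD; [exact: cvg_id|exact: ray_integral_continuous].
have phi_surj y : exists x, phi x = y.
  (* With slope at least 1/2, [phi] moves by at least [|y - phi 0|] over the distance [d], so [y]
     lies between [phi (- d)] and [phi d]. *)
  pose d := 2 * `|y - phi 0|.
  have d0 : 0 <= d by rewrite /d mulr_ge0.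
  have h1 : phi (- d) <= y.
    have := phi_half (- d) 0; rewrite oppr_le0 => /(_ d0).
    have : - (y - phi 0) <= `|y - phi 0| by rewrite -normrN ler_norm.
    rewrite /d; lra.
  have h2 : y <= phi d.
    have := phi_half 0 d d0.
    have : (y - phi 0) <= `|y - phi 0| by rewrite ler_norm.
    rewrite /d; lra.
  have dd : - d <= d by rewrite (le_trans _ d0)// oppr_le0.
  have [||c _ cy] := @IVT R phi (- d) d y dd.
  - exact: continuous_subspaceT.
  - by rewrite ge_min le_max h1 h2 orbT.
  - by exists c.
have [psi psiK] := choice phi_surj.
have phiK : cancel phi psi.
  by move=> x; apply: (inc_inj phi_mono); rewrite psiK.
have abs_bound (D : set (lebesgueR R)) : measurable D ->
    `|\int[leb]_(x in D) q x| <= \int[leb]_x `|q x|.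
  move=> mD; apply: (le_trans (le_normr_Rintegral mD _)).
    exact: integrableS qi.
  apply: fine_le.
  - apply: integrable_fin_num => //; apply: integrable_norm.
    exact: integrableS qi.
  - by apply: integrable_fin_num => //; apply: integrable_norm.
  apply: ge0_subset_integral; [exact: mD|exact: measurableT| |by []|by []].
  apply/measurable_EFinP; apply: (@measurableT_comp _ _ _ _ R R) => //.
  by apply/measurable_EFinP; exact: measurable_int qi.
(* [q] may be nonzero at [t] itself; this point is removed from the ray as a null set. *)
have q0L : ray_integral q t = 0.
  have -> : ray_integral q t = fine (\int[leb]_(x in
      (`]-oo, t]%classic `\` [set t] : set (lebesgueR R))) (q x)%:E).
    congr fine; apply: negligible_integral.
    - by rewrite -set_itv1; exact: mitv.
    - exact: mitv.
    - by apply: integrableS qi => //; exact: mitv.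
    - exact: lebesgue_measure_set1.
  rewrite integral0_eq// => x /= [+ xt]; rewrite in_itv/= => xlt.
  rewrite q0// in_itv/= negb_and -ltNge lt_neqAle xlt andbT.
  by apply/orP; left; apply/eqP.
have q0R : ray_integral q T = 0.
  have -> : ray_integral q T = \int[leb]_x q x; last by [].
  have -> : [set: lebesgueR R] = `]-oo, T]%classic `|` `]T, +oo[%classic.
    by apply/esym/seteqP; split => // x _ /=; rewrite !in_itv/= andbT;
      have [|] := leP x T; [left|right].
  rewrite Rintegral_setU//.
  - rewrite -[LHS]addr0; congr (_ + _).
    rewrite /Rintegral integral0_eq// => x /=; rewrite in_itv/= andbT => Tx.
    by rewrite q0// in_itv/= negb_and -!ltNge Tx orbT.
  - by apply: integrableS qi => //; exact: measurableU.
  - apply/disj_set2P; apply/seteqP; split => // x /= [].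
    by rewrite !in_itv/= andbT => xa; rewrite ltNge xa.
exists phi, psi; split => //; split.
- by rewrite /phi q0L addr0.
- by rewrite /phi q0R addr0.
- by move=> x; rewrite /phi addrAC subrr add0r; exact: abs_bound.
Qed.

(** * Estimates from radial convexity *)

(** Convexity with weight [(c - b) / (c - a)] on [a], multiplied by [c - a] so that no quotient
    remains. *)
Lemma convex_three_points (R : realType) (f : R -> R) (a b c : R) :
  convex_function (`]0, +oo[ : set (convex_lmodType R^o)) f ->
  0 < a -> a <= b -> b <= c -> a < c ->
  (c - a) * f b <= (c - b) * f a + (b - a) * f c.
Proof.
move=> cf a0 ab bc ac.
have ca : 0 < c - a by rewrite subr_gt0.
have k0 : 0 <= (c - b) / (c - a) by rewrite divr_ge0 ?subr_ge0// ltW.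
have k1 : (c - b) / (c - a) <= 1 by rewrite ler_pdivrMr// mul1r lerB.
have := cf (Itv01 k0 k1) a c.
have a_in : a \in (`]0, +oo[%classic : set (convex_lmodType R^o)).
  by rewrite inE/= in_itv/= a0.
have c_in : c \in (`]0, +oo[%classic : set (convex_lmodType R^o)).
  by rewrite inE/= in_itv/= (lt_trans a0).
move=> /(_ a_in c_in); rewrite convRE/=.
have -> : conv (Itv01 k0 k1) (a : convex_lmodType R^o) c = b.
  rewrite [LHS]convRE/= /unstable.onem; field; lra.
rewrite /unstable.onem => h.
have := ler_wpM2l (ltW ca) h; congr (_ <= _).
by field; lra.
Qed.

(** [L] stands for [Lambda] at a fixed time and state. For [c < |w| <= nu] nothing changes, since
    [p = 1]. Otherwise [p^-1 *: w] lies between [w] and a vector of norm at most [3 * c + 1]: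
    [3 *: w] if [|w| <= c], the unit vector on the ray if [|w| > nu]. *)
Lemma rescaled_value_le (R : realType) (m : nat) (L : 'cV[R]_m -> R)
    (w : 'cV[R]_m) (nu c eps M p : R) :
  2 <= nu -> 0 <= c -> c < nu -> 0 <= eps -> eps <= 2^-1 ->
  (forall v, 0 <= L v) -> (forall v, `|v| <= 3 * c + 1 -> L v <= M) ->
  convex_function (`]0, +oo[ : set (convex_lmodType R^o))
    (fun r => L (r *: w)) ->
  p = Num.max 1 (`|w| / nu) - eps * (`|w| <= c)%R%:R ->
  L (p^-1 *: w) * p <= L w + M * (2 * `|w| / nu + eps).
Proof.
move=> nu2 c0 cnu eps0 eps2 L0 LM cL pdef.
have nu0 : 0 < nu by lra.
have M0 : 0 <= M.
  by apply: (le_trans (L0 0)); apply: LM; rewrite normr0; lra.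
have Nnu0 : 0 <= `|w| / nu by rewrite divr_ge0// ltW.
have [wnu|nuw] := leP `|w| nu.
  have max1 : Num.max 1 (`|w| / nu) = 1.
    by apply/max_idPl; rewrite ler_pdivrMr// mul1r.
  have [wc|cw] := leP `|w| c; last first.
    have wcF : (`|w| <= c) = false by rewrite leNgt cw.
    rewrite pdef max1 wcF mulr0 subr0 invr1 scale1r mulr1.
    by rewrite lerDl mulr_ge0// addr_ge0// -mulrA mulr_ge0.
  have pE : p = 1 - eps by rewrite pdef max1 wc mulr1.
  have p0 : 0 < p by lra.
  have L3 : L (3 *: w) <= M.
    by apply: LM; rewrite normrZ ger0_norm// ; lra.
  have i1 : 1 <= p^-1 by rewrite invf_ge1//; lra.
  have i3 : p^-1 <= 3 by rewrite -[leRHS]invrK lef_pV2 ?posrE ?invr_gt0//; lra.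
  (* Three points [1 <= 1/p < 3]. *)
  have l13 : 1 < 3 :> R by lra.
  have := convex_three_points cL ltr01 i1 i3 l13.
  rewrite scale1r => /(ler_wpM2r (ltW p0)).
  have -> : ((3 - p^-1) * L w + (p^-1 - 1) * L (3 *: w)) * p
      = (3 * p - 1) * L w + (1 - p) * L (3 *: w) by field; lra.
  have := L0 w; have := L0 (3 *: w); rewrite pE => ? ? h.
  have : eps * L w >= 0 by rewrite mulr_ge0.
  have : eps * L (3 *: w) <= eps * M by rewrite ler_wpM2l.
  have : 0 <= M * (2 * `|w| / nu) by rewrite mulr_ge0// -mulrA mulr_ge0.
  have : 0 <= eps * M by rewrite mulr_ge0.
  lra.
(* Three points [1/|w| <= 1/p < 1]. *)
have max1 : Num.max 1 (`|w| / nu) = `|w| / nu.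
  by apply/max_idPr; rewrite ler_pdivlMr// mul1r ltW.
have wc : (`|w| <= c) = false by apply/negbTE; rewrite -ltNge; lra.
have pE : p = `|w| / nu by rewrite pdef max1 wc mulr0 subr0.
have w0 : 0 < `|w| by lra.
have p1 : 1 < p by rewrite pE ltr_pdivlMr// mul1r.
have L1 : L (`|w|^-1 *: w) <= M.
  by apply: LM; rewrite normrZ ger0_norm ?invr_ge0// mulVf; lra.
have iw0 : 0 < `|w|^-1 by rewrite invr_gt0.
have i1 : `|w|^-1 <= p^-1.
  rewrite lef_pV2 ?posrE//; last lra.
  by rewrite pE ler_pdivrMr// ler_peMr//; lra.
have i2 : p^-1 <= 1 by rewrite invf_le1//; lra.
have i3 : `|w|^-1 < 1 by rewrite invf_lt1//; lra.
have := convex_three_points cL iw0 i1 i2 i3.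
rewrite scale1r => h.
have {h} : (`|w| - 1) * (L (p^-1 *: w) * p) <=
    (p - 1) * `|w| * L (`|w|^-1 *: w) + (`|w| - p) * L w.
  have := ler_wpM2r (ltW (mulr_gt0 (lt_trans ltr01 p1) w0)) h.
  have pn0 : p != 0 by rewrite gt_eqF//; lra.
  have wn0 : `|w| != 0 by rewrite gt_eqF.
  by congr (_ <= _); field; rewrite ?pn0 ?wn0.
have pM : (p - 1) * `|w| * L (`|w|^-1 *: w) <= (p * `|w|) * M.
  by rewrite ler_pM ?mulr_ge0 ?ler_pM2r//; lra.
have pL : (`|w| - p) * L w <= (`|w| - 1) * L w by rewrite ler_wpM2r//; lra.
move=> h.
have {h pM pL} h : (`|w| - 1) * (L (p^-1 *: w) * p) <=
    (`|w| - 1) * (L w + M * (2 * p)).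
  (* Since [|w| > nu >= 2], [|w|] is at most [2 * (|w| - 1)]; the factor [|w| - 1] can then be
     cancelled, at the price of the constant 2. *)
  have : (p * M) * `|w| <= (p * M) * (2 * (`|w| - 1)).
    by rewrite ler_wpM2l ?mulr_ge0//; lra.
  nra.
rewrite ler_pM2l in h; last lra.
apply: (le_trans h); rewrite lerD2l ler_wpM2l// pE mulrA.
by rewrite lerDl.
Qed.

(** As [k / nu <= 1/2], a positive [X] first satisfies the crude bound [X <= 2 * (J + C)]. Inserted
    in the term [k / nu * X], it leaves an error of at most [(C + 2 * k * (J + C)) / nu <= eta]. *)
Lemma absorb_error (R : realType) (X J C k eta nu : R) :
  0 <= J -> 0 <= C -> 0 <= k -> 0 < eta -> 1 <= nu -> 2 * k <= nu ->
  (C + 2 * k * (J + C)) / eta <= nu ->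
  (1 - k / nu) * X <= J + C / nu -> X <= J + eta.
Proof.
move=> J0 C0 k0 e0 nu1 knu nuE h.
have nu0 : 0 < nu by lra.
have i0 : 0 < nu^-1 by rewrite invr_gt0.
have i1 : nu^-1 <= 1 by rewrite invf_le1.
have kn : k * nu^-1 <= 2^-1 by rewrite ler_pdivrMr//; lra.
have [X0|X0] := leP X 0; first lra.
have Cn : C * nu^-1 <= C by rewrite ler_piMr.
have X2 : X <= 2 * (J + C).
  have : (2^-1) * X <= (1 - k / nu) * X.
    by apply: ler_wpM2r; [exact: ltW|lra].
  lra.
have kX : k / nu * X <= k / nu * (2 * (J + C)).
  by rewrite ler_wpM2l// mulr_ge0// ltW.
have : (C + 2 * k * (J + C)) / nu <= eta.
  by rewrite ler_pdivrMr// [eta * _]mulrC -ler_pdivrMr.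
have -> : (C + 2 * k * (J + C)) / nu = C / nu + k / nu * (2 * (J + C)) by ring.
lra.
Qed.

(** * The derivative of the time change *)

Lemma measurable_sublevel d (T : measurableType d) (R : realType)
    (D : set T) (f : T -> R) (c : R) : measurable D -> measurable_fun setT f ->
  measurable (D `&` [set x | f x <= c]).
Proof.
move=> mD mf; apply: measurableI => //.
rewrite (_ : [set x | _] = f @^-1` `]-oo, c]%classic); last first.
  by apply/seteqP; split => x /=; rewrite in_itv/=.
by rewrite -[X in measurable X]setTI; exact: mf.
Qed.

(** [D] is the union of these sublevel sets, and a countable union of null sets is null. *)
Lemma sublevel_measure_neq0 d (T : measurableType d) (R : realType)
    (mu : {measure set T -> \bar R}) (D : set T) (f : T -> R) :
  measurable D -> mu D != 0%E -> measurable_fun setT f ->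
  exists k : nat, mu (D `&` [set x | f x <= k%:R]) != 0%E.
Proof.
move=> mD D0 mf; apply: contrapT => /forallNP h.
move/eqP: D0; apply.
have : mu.-negligible (\bigcup_k (D `&` [set x | f x <= k%:R])).
  apply: negligible_bigcup => k; apply/negligibleP.
    exact: measurable_sublevel.
  by apply/eqP/negPn/negP; exact: h.
move=> /negligibleS nD; apply: (measure_negligible mD); apply: nD => x Dx.
by exists (Num.truncn `|f x|).+1 => //=; split => //=;
  apply: (le_trans (ler_norm _)); exact/ltW/truncnS_gt.
Qed.

(* [1 + q] is the derivative of the time change when [N] is the norm of the
   control. *)
Lemma time_weight d (X : measurableType d) (R : realType)
    (mu : {measure set X -> \bar R}) (D : set X) (N : X -> R) :
  measurable D -> mu D != 0%E -> (mu D < +oo)%E ->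
  (forall x, 0 <= N x) -> (forall x, ~ D x -> N x = 0) ->
  mu.-integrable setT (EFin \o N) ->
  exists c sigma : R, [/\ 0 <= c, 0 < sigma & forall nu : R, c < nu ->
    (\int[mu]_x N x) / nu <= sigma / 2 ->
    exists eps : R, [/\ 0 <= eps, eps <= 2^-1,
      eps <= (\int[mu]_x N x) / sigma / nu &
      let q x := Num.max 1 (N x / nu)
                 - eps * \1_(D `&` [set x | N x <= c]) x - 1 in
      [/\ mu.-integrable setT (EFin \o q), forall x, - 2^-1 <= q x,
          forall x, ~ D x -> q x = 0, \int[mu]_x q x = 0 &
          \int[mu]_x `|q x| <= 2 * (\int[mu]_x N x) / nu]]].
Proof.
move=> mD D0 Doo N0 ND iN.
have mN : measurable_fun setT N by apply/measurable_EFinP; exact: measurable_int iN.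
(* This level serves as [c]. It is fixed before [nu], so constants built on it do not change as [nu]
   grows. *)
have [k Sk] := sublevel_measure_neq0 mD D0 mN.
set B := \int[mu]_x N x.
set Sg := D `&` _ in Sk.
have mS : measurable Sg by exact: measurable_sublevel.
have Soo : (mu Sg < +oo)%E.
  by apply: le_lt_trans Doo; apply: le_measure; rewrite ?inE//; exact: subIsetl.
have Sfin : mu Sg \is a fin_num by rewrite ge0_fin_numE.
have s0 : 0 < fine (mu Sg) by rewrite fine_gt0// lt0e Sk measure_ge0.
set s := fine (mu Sg) in s0.
have i1 : mu.-integrable setT (EFin \o \1_Sg).
  apply/integrableP; split; first exact/measurable_EFinP.
  under eq_integral do rewrite /= ger0_norm//.
  by rewrite integral_indic// setIT.
have iS (r : R) : mu.-integrable setT (EFin \o (fun x => r * \1_Sg x)).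
  have := integrableZl measurableT r i1.
  by apply: eq_integrable => // x _ /=; rewrite EFinM.
exists k%:R, s; split => // nu cnu Bnu.
have nu0 : 0 < nu by apply: le_lt_trans cnu.
(* The excess over 1 before correction; it lies between 0 and [N / nu], so its integral [e] is at
   most [B / nu]. *)
pose h x := Num.max 1 (N x / nu) - 1.
have h0 x : 0 <= h x by rewrite /h subr_ge0 le_max lexx.
have hN x : h x <= N x / nu.
  rewrite /h lerBlDr ge_max lerDr divr_ge0//=; first by rewrite lerDl.
  exact: ltW.
have mh : measurable_fun setT h.
  apply: measurable_funB => //; apply: measurable_maxr => //.
  by apply: measurable_funM.
have iNnu : mu.-integrable setT (EFin \o (fun x => N x / nu)).
  have := integrableZr measurableT nu^-1 iN.
  by apply: eq_integrable => // x _ /=; rewrite EFinM.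
have ih : mu.-integrable setT (EFin \o h).
  apply: le_integrable iNnu => //; first exact/measurable_EFinP.
  move=> x _ /=; rewrite lee_fin !ger0_norm// divr_ge0//; exact: ltW.
pose e := \int[mu]_x h x.
have e0 : 0 <= e by apply: Rintegral_ge0.
have eB : e <= B / nu.
  rewrite /B -RintegralZr//; exact: le_Rintegral.
have intS (r : R) : \int[mu]_x (r * \1_Sg x) = r * s.
  rewrite RintegralZl//.
  by rewrite /s /Rintegral integral_indic// setIT.
(* Lowering the slope by [e / s] on [Sg], of measure [s], removes exactly the integral of [h]; hence
   [q] has integral zero. *)
exists (e / s); split.
- by rewrite divr_ge0// ltW.
- rewrite ler_pdivrMr// mulrC; apply: (le_trans eB); apply: (le_trans Bnu).
  by rewrite mulrC.
- by rewrite mulrAC ler_pM2r ?invr_gt0.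
move=> q.
have qE : q = (fun x => h x - e / s * \1_Sg x).
  by apply/funext => x; rewrite /q /h; ring.
have iq : mu.-integrable setT (EFin \o q).
  rewrite qE; have := integrableB measurableT ih (iS (e / s)).
  by apply: eq_integrable => // x _ /=; rewrite EFinB.
have ind_eps x : 0 <= e / s * \1_Sg x <= 2^-1.
  rewrite indicE; case: (_ \in _); rewrite ?mulr1 ?mulr0; last first.
    by rewrite lexx/= invr_ge0.
  rewrite divr_ge0//=; last exact: ltW.
  by rewrite ler_pdivrMr// mulrC; apply: (le_trans eB).
split => //.
- by move=> x; rewrite qE; have := ind_eps x; have := h0 x; lra.
- move=> x Dx; rewrite qE /h ND// mul0r indicE memNset; last by case.
  by rewrite mulr0 subr0 max_l// subrr.
- rewrite qE RintegralB// intS mulfVK ?subrr//; exact: lt0r_neq0.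
(* [h] and the subtracted part each have integral [e <= B / nu], whence the factor 2. *)
- have -> : 2 * B / nu = B / nu + B / nu by ring.
  apply: (@le_trans _ _ (\int[mu]_x (h x + e / s * \1_Sg x))).
    apply: le_Rintegral => //.
    + exact: integrable_norm.
    + have := integrableD measurableT ih (iS (e / s)).
      by apply: eq_integrable => // x _ /=; rewrite EFinD.
    + move=> x _; rewrite qE; apply: (le_trans (ler_normB _ _)).
      by rewrite !ger0_norm//; have /andP[] := ind_eps x.
  by rewrite RintegralD// intS mulfVK ?lerD//; exact: lt0r_neq0.
Qed.

(** * Primitives of integrable vector-valued maps *)

Lemma cV_norm_le (R : realType) k (v : 'cV[R]_k) (c : R) : 0 <= c ->
  (forall i, `|v i ord0| <= c) -> `|v| <= c.
Proof.
move=> c0 vc; rewrite [leLHS]/Num.norm/= mx_normrE; apply/bigmax_leP; split => //.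
by move=> [i j] _ /=; rewrite (ord1 j).
Qed.

Lemma cV_coord_le (R : realType) k (v : 'cV[R]_k) i : `|v i ord0| <= `|v|.
Proof.
rewrite [leRHS]/Num.norm/= mx_normrE; apply/bigmax_geP; right => /=.
by exists (i, ord0).
Qed.

Lemma measurable_inv_gt0 d (X : measurableType d) (R : realType) (D : set X)
    (f : X -> R) : measurable_fun D f -> (forall x, 0 < f x) ->
  measurable_fun D (fun x => (f x)^-1).
Proof.
move=> mf f0.
have minv : measurable_fun (`]0, +oo[%classic : set R) (@GRing.inv R).
  apply: open_continuous_measurable_fun; first exact: interval_open.
  move=> x; rewrite inE/= in_itv/= andbT => x0.
  by apply: inv_continuous; rewrite gt_eqF.
apply: (measurable_comp _ _ minv mf); first exact: measurable_itv.
by move=> _ [x _ <-]; rewrite /= in_itv/= f0.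
Qed.

Section W11.
Variables (R : realType) (n : nat) (t T : R) (y v : R -> 'cV[R]_n).
Hypotheses (tT : t <= T) (yv : W11_with_derivative t T y v).
Local Notation D := (`[t, T]%classic : set (lebesgueR R)).

Let mD : measurable D. Proof. exact: lebesgue_measurable_itv. Qed.

Let vi i := (fun s : lebesgueR R => v s i ord0).

Let ivi i : leb.-integrable setT (EFin \o (vi i \_ D)).
Proof.
rewrite -restrict_EFin; apply/integrable_restrict => //; rewrite setTI.
exact: yv.1.
Qed.

(** Extending the derivative by zero off [[t, T]] makes it integrable on the line, so the continuity
    and increment formulas of [ray_integral] apply to [y]. *)
Lemma W11_ray s i : s \in `[t, T] ->
  y s i ord0 = y t i ord0 + ray_integral (vi i \_ D) s.
Proof.
move=> sD; rewrite (yv.2 s sD i); congr (_ + _).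
rewrite /ray_integral -Rintegral_mkcondr; congr Rintegral.
move: sD; rewrite in_itv/= => /andP[ts sT].
apply/seteqP; split => x /=; rewrite !in_itv/=.
  by move=> /andP[-> xs]; split => //=; exact: le_trans sT.
by move=> [-> /andP[->]].
Qed.

Lemma W11_bounded : exists2 c, 0 <= c & forall s, s \in `[t, T] -> `|y s| <= c.
Proof.
pose I i := \int[leb]_x `|(vi i \_ D) x|.
have I0 i : 0 <= I i by apply: Rintegral_ge0.
exists (`|y t| + \sum_i I i); first by rewrite addr_ge0// sumr_ge0.
move=> s sD; apply: cV_norm_le; first by rewrite addr_ge0// sumr_ge0.
move=> i; rewrite (W11_ray i sD); apply: (le_trans (ler_normD _ _)).
apply: lerD; first exact: cV_coord_le.
rewrite (bigD1 i)//= -[leLHS]addr0; apply: lerD; last by rewrite sumr_ge0.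
have mr : measurable (`]-oo, s]%classic : set (lebesgueR R)).
  exact: lebesgue_measurable_itv.
have ir : leb.-integrable (`]-oo, s]%classic : set (lebesgueR R))
    (EFin \o (vi i \_ D)) by exact: integrableS (ivi i).
apply: (le_trans (le_normr_Rintegral mr ir)).
apply: fine_le.
- by apply: integrable_fin_num => //; exact: (integrable_norm ir).
- by apply: integrable_fin_num => //; exact: (integrable_norm (ivi i)).
- apply: ge0_subset_integral; [exact: mr|exact: measurableT| |by []|by []].
  apply/measurable_EFinP; apply: (@measurableT_comp _ _ _ _ R R) => //.
  by apply/measurable_EFinP; exact: measurable_int (ivi i).
Qed.

Lemma W11_measurable :
  @measurable_fun _ _ (lebesgueR R) (borelType 'cV[R]_n) D y.
Proof.
apply: (@measurable_fun_cV _ (lebesgueR R) R n D y mD) => i.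
apply: (@eq_measurable_fun _ _ (lebesgueR R) R D
  (fun s => y t i ord0 + ray_integral (vi i \_ D) s)).
  by move=> s; rewrite inE => /= sD; rewrite -W11_ray.
apply: measurable_funTS.
have mr : @measurable_fun _ _ (lebesgueR R) R setT (ray_integral (vi i \_ D)).
  apply: measurable_fun_lebesgueR; apply: continuous_measurable_fun.
  exact: ray_integral_continuous.
exact: (@measurable_funD _ (lebesgueR R) R setT (cst (y t i ord0)) _ _ mr).
Qed.

(** Increments of a coordinate are integrals of a function bounded by [c] almost everywhere; the
    supremum norm keeps the same constant. *)
Lemma W11_lipschitz (c : R) : 0 <= c ->
  {ae leb, forall s : lebesgueR R, s \in `[t, T] -> `|v s| <= c} ->
  [lipschitz y s | s in `[t, T]].
Proof.
move=> c0 vc.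
have key i a b : a \in `[t, T] -> b \in `[t, T] -> a <= b ->
    `|y b i ord0 - y a i ord0| <= c * (b - a).
  move=> aD bD ab; rewrite (W11_ray i bD) (W11_ray i aD) opprD addrACA subrr add0r.
  rewrite ray_integralB//.
  have mab : measurable (`]a, b]%classic : set (lebesgueR R)).
    exact: lebesgue_measurable_itv.
  have iab : leb.-integrable (`]a, b]%classic : set (lebesgueR R))
    (EFin \o (vi i \_ D)) by exact: integrableS (ivi i).
  apply: (le_trans (le_normr_Rintegral mab iab)).
  have -> : c * (b - a) =
      \int[leb]_(x in (`]a, b]%classic : set (lebesgueR R))) c.
    by rewrite Rintegral_cst// [X in fine X]leb_itvoc.
  apply: fine_le.
  - by apply: integrable_fin_num => //; exact: (integrable_norm iab).
  - apply: integrable_fin_num => //; apply: integrable_cst => //.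
    by rewrite [ltLHS]leb_itvoc// ltry.
  apply: (ae_ge0_le_integral mab).
  - by [].
  - apply/measurable_EFinP; apply: (@measurableT_comp _ _ _ _ R R) => //.
    by apply/measurable_EFinP; exact: measurable_int iab.
  - by move=> x _; rewrite lee_fin.
  - exact: measurable_cst.
  - apply: filterS vc => x vxc _; rewrite lee_fin patchE.
    case: ifPn => [|_]; last by rewrite normr0.
    by rewrite inE/= => xD; apply: (le_trans (cV_coord_le _ _)); exact: vxc.
have key' a b : a \in `[t, T] -> b \in `[t, T] -> `|y a - y b| <= c * `|a - b|.
  move=> aD bD; apply: cV_norm_le; first by rewrite mulr_ge0.
  move=> i; rewrite !mxE; have [ab|/ltW ba] := leP a b.
    by rewrite distrC (distrC a b) [`|b - a|]ger0_norm ?subr_ge0//; exact: key.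
  by rewrite [`|a - b|]ger0_norm ?subr_ge0//; exact: key.
exists c; split; first exact: num_real.
move=> M cM [a b]/= [aD bD].
by apply: (le_trans (key' a b aD bD)); rewrite ler_wpM2r// ltW.
Qed.

(** * Reparametrized trajectories *)

Section time_change.
Variables (phi psi : R -> R) (p : lebesgueR R -> R).
Hypotheses (phiK : cancel phi psi) (psiK : cancel psi phi).
Hypothesis phi_mono : {mono phi : x y / x <= y}.
Hypotheses (mp : measurable_fun setT p) (p_gt0 : forall x, 0 < p x).
Hypothesis phi_primitive : forall a b : R, a <= b ->
  (\int[leb]_(x in (`]a, b] : set (lebesgueR R))) (p x)%:E =
   (phi b - phi a)%:E)%E.
Hypotheses (phi_t : phi t = t) (phi_T : phi T = T).

Lemma psi_t : psi t = t. Proof. by rewrite -{1}phi_t phiK. Qed.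
Lemma psi_T : psi T = T. Proof. by rewrite -{1}phi_T phiK. Qed.

Lemma phi_itv s : (phi s \in `[t, T]) = (s \in `[t, T]).
Proof. by rewrite !in_itv/= -{1}phi_t -{1}phi_T !phi_mono. Qed.

Lemma psi_itv s : (psi s \in `[t, T]) = (s \in `[t, T]).
Proof. by rewrite -phi_itv psiK. Qed.

Lemma preimage_phi_D : phi @^-1` D = D.
Proof. by apply/seteqP; split => s; rewrite /= phi_itv. Qed.

Lemma measurable_fun_comp_psi d (X : measurableType d) (f : R -> X) :
  @measurable_fun _ _ (lebesgueR R) X D f ->
  @measurable_fun _ _ (lebesgueR R) X D (f \o psi).
Proof.
move=> mf; have mpsi := lebesgue_measurable_psi phiK psiK phi_mono mp p_gt0 phi_primitive.
have sub : psi @` D `<=` D by move=> _ [s sD <-]; rewrite /= psi_itv.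
exact: (measurable_comp mD sub mf (measurable_funTS mpsi)).
Qed.

(** Substituting [phi] multiplies the integrand by [p], which cancels the factor [p^-1]. This is
    used on absolute values for integrability, then on [[t, s]], whose preimage is [[t, psi s]]. *)
Lemma W11_time_change : W11_with_derivative t T (y \o psi)
  (fun s => (p (psi s))^-1 *: v (psi s)).
Proof.
pose F i : lebesgueR R -> R := (fun s => (p s)^-1 * v s i ord0) \o psi.
have mF i : measurable_fun D (F i).
  apply: measurable_fun_comp_psi; apply: measurable_funM.
    by apply: measurable_inv_gt0 => //; exact: measurable_funTS.
  exact/measurable_EFinP/(measurable_int _ (yv.1 i)).
have Fphi i x : F i (phi x) * p x = v x i ord0.
  by rewrite /F/= phiK mulrAC mulVf ?mul1r// gt_eqF.
split => [i|s sD i].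
  apply: (@eq_integrable _ _ _ leb _ mD (EFin \o F i)).
    by move=> s _ /=; rewrite /F/= mxE.
  apply/integrableP; split; first exact/measurable_EFinP.
  have mFn : measurable_fun D (fun s => `|(F i s)%:E|%E).
    by apply: measurableT_comp; [exact: abse_measurable|exact/measurable_EFinP].
  rewrite (ge0_integral_change phiK psiK phi_mono mp p_gt0 phi_primitive mD mFn);
    last by [].
  rewrite preimage_phi_D; have /integrableP[_] := yv.1 i.
  apply: le_lt_trans; rewrite le_eqVlt; apply/orP; left; apply/eqP.
  apply: eq_integral => x _; rewrite /F/= -EFinM phiK normrM mulrAC.
  by rewrite [`|(p x)^-1|]gtr0_norm ?invr_gt0// mulVf ?gt_eqF// mul1r.
rewrite /= psi_t (yv.2 (psi s)) ?psi_itv//; congr (_ + _).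
have -> : \int[leb]_(r in (`[t, s] : set (lebesgueR R)))
    ((p (psi r))^-1 *: v (psi r)) i ord0 =
  \int[leb]_(r in (`[t, s] : set (lebesgueR R))) F i r.
  by apply: eq_Rintegral => r _; rewrite mxE.
rewrite /Rintegral; congr fine.
rewrite [RHS](integral_change phiK psiK phi_mono mp p_gt0 phi_primitive).
- rewrite (preimage_phi_itvcc phiK psiK phi_mono) psi_t.
  by apply: eq_integral => x _; rewrite -EFinM Fphi.
- exact: lebesgue_measurable_itv.
- apply/measurable_EFinP; apply: measurable_funS (mF i) => //.
  move=> r /=; rewrite !in_itv/= => /andP[-> rs]/=.
  by apply: (le_trans rs); move: sD; rewrite in_itv/= => /andP[].
Qed.

End time_change.
End W11.

(** * The running cost *)

Lemma leb_itvcc (R : realType) (a b : R) : a <= b ->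
  leb (`[a, b]%classic : set (lebesgueR R)) = (b - a)%:E.
Proof.
move=> ab; rewrite leb_borel lebesgue_measure_itv/= lte_fin -EFinB.
by move: ab; rewrite le_eqVlt => /orP[/eqP->|->//]; rewrite ltxx subrr.
Qed.

Lemma bounded_on_bounded_setsP (R : realType) (n m : nat) (T : R)
    (Lambda : R -> 'cV[R]_n -> 'cV[R]_m -> R) (r c : R) :
  0 <= r -> 0 <= c -> bounded_on_bounded_sets T Lambda ->
  exists M, forall s y w, s \in `[0, T] -> `|y| <= r -> `|w| <= c ->
    Lambda s y w <= M.
Proof.
move=> r0 c0 bL.
pose B := [set z : R * ('cV[R]_n * 'cV[R]_m) |
  [/\ z.1 \in `[0, T], `|z.2.1| <= r & `|z.2.2| <= c]].
have bB : bounded_set B.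
  exists (`|T| + r + c); split; first exact: num_real.
  move=> K rK [s [y w]]/= [sT yr wc].
  rewrite !prod_normE/= !ge_max; apply/and3P; split.
  - move: sT; rewrite in_itv/= => /andP[s0 sT].
    rewrite ger0_norm//; apply: (le_trans sT); apply: (le_trans (ler_norm _)).
    lra.
  - by have := normr_ge0 T; lra.
  - by have := normr_ge0 T; lra.
have [|M [Mreal HM]] := bL B bB.
  by move=> [s [y w]] [/=].
(* Boundedness provides the estimate only for constants strictly above [M]. *)
exists (M + 1) => s y w sT yr wc.
have := HM (M + 1); rewrite ltrDl => /(_ ltr01 (s, (y, w))) /= h.
by apply: (le_trans (ler_norm _)); exact: h.
Qed.

Lemma running_cost_measurable (R : realType) (n m : nat) (t T : R)
    (Lambda : R -> 'cV[R]_n -> 'cV[R]_m -> R)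
    (y : R -> 'cV[R]_n) (u : R -> 'cV[R]_m) :
  0 <= t -> Lebesgue_Borel_measurable T Lambda ->
  @measurable_fun _ _ (lebesgueR R) (borelType 'cV[R]_n) `[t, T] y ->
  @measurable_fun _ _ (lebesgueR R) (borelType 'cV[R]_m) `[t, T] u ->
  @measurable_fun _ _ (lebesgueR R) R `[t, T]
    (fun s => Lambda s (y s) (u s)).
Proof.
move=> t0 mL my mu.
have mD := lebesgue_measurable_itv `[t, T].
have myu := measurable_fun_cV_pair mD my mu.
have mE : measurable (`[0, T] `*` setT :
    set (lebesgueR R * borelType ('cV[R]_n * 'cV[R]_m)%type)%type).
  by apply: measurableX => //; exact: lebesgue_measurable_itv.
(* Off [[t, T]] the pair takes a default value, which makes it measurable on the whole line. *)
pose yu : lebesgueR R -> borelType ('cV[R]_n * 'cV[R]_m)%type :=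
  (fun s => (y s, u s)) \_ (`[t, T]%classic : set (lebesgueR R)).
have myu' : measurable_fun setT yu by exact/(measurable_restrictT _ mD).
pose f (s : lebesgueR R) :
    (lebesgueR R * borelType ('cV[R]_n * 'cV[R]_m)%type)%type := (s, yu s).
have mf : measurable_fun setT f by exact: measurable_fun_pair.
pose D : set (lebesgueR R) := `[t, T]%classic.
have sub : f @` D `<=` `[0, T] `*` setT.
  move=> _ [s sD <-]; split => //; move: sD; rewrite /D/= !in_itv/=.
  by move=> /andP[ts sT]; rewrite (le_trans t0 ts) sT.
have mfD : measurable_fun D f by exact: measurable_funTS.
have := @measurable_comp _ _ _ (lebesgueR R) _ R _ _ D f mE sub mL mfD.
by apply: eq_measurable_fun => s sD; rewrite /= /yu patchE sD.
Qed.

(** [Lphi] and [Ltau] are the values of [Lambda] at the shifted and the original time, [w] is the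
    norm of the rescaled control. The term [kappa * Lphi] of Condition (S) moves to the left-hand
    side, whence the factor [1 - kappa * del]. *)
Lemma shifted_cost_le (R : realType) (Lphi Ltau w p G K kappa A gam del N d : R) :
  `|Lphi - Ltau| <= (kappa * Lphi + A * w + gam) * d -> 0 <= d -> d <= del ->
  Ltau * p <= G + K -> w * p = N -> 0 <= Lphi -> 0 < p -> 0 <= kappa ->
  0 <= A -> 0 <= w ->
  (1 - kappa * del) * (Lphi * p) <= G + K + del * (A * N + `|gam| * p).
Proof.
move=> h d0 ddel hL <- L0 p0 k0 A0 w0.
have h1 : Lphi - Ltau <= (kappa * Lphi + A * w + `|gam|) * del.
  apply: (le_trans (ler_norm _)); apply: (le_trans h).
  apply: (@le_trans _ _ ((kappa * Lphi + A * w + `|gam|) * d)).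
    by rewrite ler_wpM2r// lerD2l ler_norm.
  by rewrite ler_wpM2l// !addr_ge0// mulr_ge0.
have := ler_wpM2r (ltW p0) h1.
lra.
Qed.

(** Coercivity bounds [|u|] by [(Lambda + d) / alpha] almost everywhere, and [[t, T]] has finite
    measure. *)
Lemma control_integrable (R : realType) (n m : nat) (t T : R)
    (Lambda : R -> 'cV[R]_n -> 'cV[R]_m -> R) (U : set 'cV[R]_m)
    (y : R -> 'cV[R]_n) (u : R -> 'cV[R]_m) :
  0 <= t -> t <= T -> coercive T Lambda U ->
  @measurable_fun _ _ (lebesgueR R) (borelType 'cV[R]_m) `[t, T] u ->
  {ae leb, forall s : lebesgueR R, s \in `[t, T] -> U (u s)} ->
  leb.-integrable (`[t, T]%classic : set (lebesgueR R))
    (fun s => (Lambda s (y s) (u s))%:E) ->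
  leb.-integrable setT
    (EFin \o ((fun s : lebesgueR R => `|u s|) \_ `[t, T]%classic)).
Proof.
move=> t0 tT [al [d [al0 d0 co]]] mu Uu iG.
have mD := lebesgue_measurable_itv `[t, T].
have mN := measurable_fun_cV_norm mu.
rewrite -restrict_EFin; apply/integrable_restrict => //; rewrite setTI.
have Doo : (leb (`[t, T]%classic : set (lebesgueR R)) < +oo)%E.
  by rewrite [ltLHS]leb_itvcc// ltry.
have iK := integrableZl mD al^-1 (integrableD mD iG (integrable_cst d mD Doo)).
have iK' := integrable_norm iK.
apply/integrableP; split; first exact/measurable_EFinP.
have /integrableP[mK Koo] := iK; apply: le_lt_trans Koo.
apply: (ae_ge0_le_integral mD).
- by [].
- by apply: measurableT_comp => //; exact/measurable_EFinP.
- by [].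
- exact: measurableT_comp mK.
apply: filterS2 co Uu => s co Uu sD.
have s0T : s \in `[0, T].
  by move: sD; rewrite /= !in_itv/= => /andP[ts ->]; rewrite (le_trans t0).
have {}co := co s0T (y s) _ (Uu sD).
rewrite /= lee_fin normr_id; apply: le_trans (ler_norm _).
by rewrite mulrC ler_pdivlMr// mulrC -lerBlDr.
Qed.

(** Integrals of nonnegative functions are kept extended real valued, so that [H] may have an
    infinite integral: finiteness of the new cost is to be deduced from this estimate. *)
Lemma integral_error_le d (X : measurableType d) (R : realType)
    (mu : {measure set X -> \bar R}) (D : set X) (l : R)
    (G H N W : X -> R) (a c1 c2 del : R) :
  measurable D -> mu D = l%:E ->
  measurable_fun D G -> measurable_fun D H -> measurable_fun D W ->
  mu.-integrable setT (EFin \o N) ->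
  (forall x, D x -> 0 <= G x) -> (forall x, D x -> 0 <= H x) ->
  (forall x, 0 <= N x) -> (forall x, D x -> 0 <= W x) ->
  0 <= a -> 0 <= c1 -> 0 <= c2 -> 0 <= del ->
  {ae mu, forall x, D x ->
    a * H x <= G x + (c1 * N x + c2) + del * W x} ->
  (a%:E * \int[mu]_(x in D) (H x)%:E <=
    \int[mu]_(x in D) (G x)%:E + (c1 * \int[mu]_x N x + c2 * l)%:E
    + del%:E * \int[mu]_(x in D) (W x)%:E)%E.
Proof.
move=> mD lD mG mH mW iN G0 H0 N0 W0 a0 c10 c20 del0 HK.
have mN : measurable_fun setT N.
  by apply/measurable_EFinP; exact: measurable_int iN.
have mND : measurable_fun D N by exact: measurable_funTS.
have mc1N : measurable_fun D (fun x => c1 * N x).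
  exact: (measurable_funM (measurable_cst c1) mND).
have mK1 : measurable_fun D (fun x => c1 * N x + c2).
  exact: (measurable_funD mc1N (measurable_cst c2)).
have mdW : measurable_fun D (fun x => del * W x).
  exact: (measurable_funM (measurable_cst del) mW).
have mGK : measurable_fun D (fun x => G x + (c1 * N x + c2)).
  exact: measurable_funD mG mK1.
have c1N0 x : 0 <= c1 * N x by exact: mulr_ge0.
have K10 x : 0 <= c1 * N x + c2 by exact: addr_ge0.
have dW0 x : D x -> 0 <= del * W x by move=> Dx; rewrite mulr_ge0// W0.
have GK0 x : D x -> 0 <= G x + (c1 * N x + c2).
  by move=> Dx; rewrite addr_ge0// G0.
have intN : (\int[mu]_(x in D) (N x)%:E <= (\int[mu]_x N x)%:E)%E.
  rewrite /Rintegral fineK; last exact: integrable_fin_num.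
  apply: ge0_subset_integral => //; first exact/measurable_EFinP.
  by move=> x _; rewrite lee_fin.
rewrite -ge0_integralZl//; last exact/measurable_EFinP.
rewrite -ge0_integralZl//; last exact/measurable_EFinP.
apply: (@le_trans _ _ (\int[mu]_(x in D)
    (G x + (c1 * N x + c2) + del * W x)%:E)%E).
  apply: (ae_ge0_le_integral mD).
  - by move=> x Dx; rewrite -EFinM lee_fin mulr_ge0// H0.
  - exact/measurable_EFinP/(measurable_funM (measurable_cst a) mH).
  - by move=> x Dx; rewrite lee_fin addr_ge0// ?GK0// dW0.
  - exact/measurable_EFinP/(measurable_funD mGK mdW).
  - by apply: filterS HK => x HKx Dx; rewrite -EFinM lee_fin HKx.
have split2 (f1 f2 : X -> R) : measurable_fun D f1 -> measurable_fun D f2 ->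
    (forall x, D x -> 0 <= f1 x) -> (forall x, D x -> 0 <= f2 x) ->
    (\int[mu]_(x in D) (f1 x + f2 x)%:E =
     \int[mu]_(x in D) (f1 x)%:E + \int[mu]_(x in D) (f2 x)%:E)%E.
  move=> m1 m2 f1_ge0 f2_ge0.
  under eq_integral do rewrite EFinD.
  by apply: ge0_integralD => //; exact/measurable_EFinP.
rewrite !split2//.
have -> : (\int[mu]_(x in D) (del * W x)%:E =
    \int[mu]_(x in D) (del%:E * (W x)%:E))%E.
  by apply: eq_integral => x _; rewrite EFinM.
rewrite leeD2r// leeD2l// integral_cst// lD EFinD leeD//.
have -> : (\int[mu]_(x in D) (c1 * N x)%:E =
    c1%:E * \int[mu]_(x in D) (N x)%:E)%E.
  under eq_integral do rewrite EFinM.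
  apply: ge0_integralZl => //; first exact/measurable_EFinP.
  by move=> x _; rewrite lee_fin.
by rewrite EFinM lee_wpmul2l.
Qed.

(** * Approximation by Lipschitz trajectories *)

Lemma exists_large (R : realType) (c a1 a2 a3 a4 : R) :
  0 <= c -> 0 <= a1 -> 0 <= a2 -> 0 <= a3 -> 0 <= a4 ->
  exists nu : R, [/\ 2 <= nu, c < nu, a1 <= nu, a2 <= nu &
    a3 <= nu /\ a4 <= nu].
Proof.
move=> c0 h1 h2 h3 h4; exists (2 + c + a1 + a2 + a3 + a4).
by split; [| | | |split]; lra.
Qed.

(** The time change is carried out for one pair and one tolerance [eta]; comparing the infima then
    only requires [eta] to be arbitrary. *)
Lemma lipschitz_approximation (R : realType) (n m : nat) (T : R)
    (Lambda : R -> 'cV[R]_n -> 'cV[R]_m -> R)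
    (b : 'cV[R]_n -> 'M[R]_(n, m))
    (S : set 'cV[R]_n) (U : set 'cV[R]_m) (g : 'cV[R]_n -> \bar R)
    (Lambda_ge0 : forall s y u, s \in `[0, T] -> 0 <= Lambda s y u)
    (Lambda_meas : Lebesgue_Borel_measurable T Lambda)
    (b_growth : linear_growth b)
    (U_cone : cone U)
    (g_ge0 : forall x, S x -> (0 <= g x)%E)
    (Lambda_coercive : coercive T Lambda U)
    (Lambda_bounded : bounded_on_bounded_sets T Lambda)
    (Lambda_S : condition_S T Lambda U)
    (Lambda_convex : radially_convex T Lambda U)
    (t : R) (x : 'cV[R]_n) (y : R -> 'cV[R]_n) (u : R -> 'cV[R]_m) (eta : R) :
  t \in `[0, T[ -> admissible T Lambda b S U g t x y u -> 0 < eta ->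
  exists (z : R -> 'cV[R]_n) (w : R -> 'cV[R]_m),
    [/\ admissible T Lambda b S U g t x z w,
        [lipschitz z s | s in `[t, T]], [bounded w s | s in `[t, T]] &
        (cost T Lambda g t z w <= cost T Lambda g t y u + eta%:E)%E].
Proof.
rewrite in_itv/= => /andP[t0 ltT] [[mu [v yv vb] ytx Uu Sy] cost_fin] eta0.

(* Bounds attached to the given pair *)
have tT := ltW ltT.
pose D : set (lebesgueR R) := `[t, T]%classic.
have mD : measurable D by exact: lebesgue_measurable_itv.
have D0T s : s \in `[t, T] -> s \in `[0, T].
  by rewrite !in_itv/= => /andP[ts ->]; rewrite (le_trans t0).
have TD : T \in `[t, T] by rewrite in_itv/= tT lexx.
have lD : leb D = (T - t)%:E by exact: leb_itvcc.
have my := W11_measurable yv.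
pose G (s : lebesgueR R) := Lambda s (y s) (u s).
have mG : measurable_fun D G by exact: running_cost_measurable.
have G0 s : D s -> 0 <= G s by move=> sD; apply: Lambda_ge0; exact: D0T.
have JG : (0 <= \int[leb]_(s in D) (G s)%:E)%E.
  by apply: integral_ge0 => s sD; rewrite lee_fin G0.
have gT0 : (0 <= g (y T))%E by apply: g_ge0; exact: Sy.
(* Since [g (y T)] is nonnegative, a finite total cost forces a finite running cost. *)
have Joo : (\int[leb]_(s in D) (G s)%:E < +oo)%E.
  by apply: le_lt_trans cost_fin; rewrite /cost leeDl.
have iG : leb.-integrable D (EFin \o G).
  apply/integrableP; split; first exact/measurable_EFinP.
  rewrite (_ : (\int[leb]_(s in D) _)%E = \int[leb]_(s in D) (G s)%:E)%E//.
  by apply: eq_integral => s; rewrite inE => sD; rewrite /= ger0_norm// G0.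
pose N : lebesgueR R -> R := (fun s : lebesgueR R => `|u s|) \_ D.
have iN : leb.-integrable setT (EFin \o N).
  exact: (control_integrable t0 tT Lambda_coercive mu Uu iG).
have N0 s : 0 <= N s by rewrite /N patchE; case: ifP.
have ND s : D s -> N s = `|u s| by move=> sD; rewrite /N patchE mem_set.
have NnD s : ~ D s -> N s = 0 by move=> sD; rewrite /N patchE memNset.
have D_neq0 : leb D != 0%E by rewrite [X in X != _]lD eqe subr_eq0 gt_eqF.
have D_fin : (leb D < +oo)%E by rewrite [ltLHS]lD ltry.
have [c [sg [c0 sg0 weight]]] := time_weight mD D_neq0 D_fin N0 NnD iN.
set B := \int[leb]_x N x in weight.
have B0 : 0 <= B by apply: Rintegral_ge0.
have [Ymax Y0 Yb] := W11_bounded yv.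
(* This radius covers both the unit vectors and the triples of vectors of norm at most [c]. *)
have c31 : 0 <= 3 * c + 1 by rewrite addr_ge0// mulr_ge0.
have [M0 LM0] := bounded_on_bounded_setsP Y0 c31 Lambda_bounded.
pose M := Num.max 0 M0.
have M_ge0 : 0 <= M by rewrite le_max lexx.
have LM s z w : s \in `[0, T] -> `|z| <= Ymax -> `|w| <= 3 * c + 1 ->
    Lambda s z w <= M.
  by move=> ? ? ?; rewrite le_max LM0// orbT.
have [kappa [A [gamma [del0 [kappa0 A0 igamma del00 condS]]]]] := Lambda_S.
have ig : leb.-integrable D (EFin \o gamma).
  apply: integrableS igamma => //; first exact: lebesgue_measurable_itv.
have igD : leb.-integrable D (EFin \o (fun s => `|gamma s|)).
  exact: (integrable_norm ig).
pose Gam := \int[leb]_(s in D) `|gamma s|.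
have Gam0 : 0 <= Gam by apply: Rintegral_ge0.
pose j := fine (\int[leb]_(s in D) (G s)%:E)%E.
have jE : (\int[leb]_(s in D) (G s)%:E)%E = j%:E.
  by rewrite fineK// ge0_fin_numE.
have j0 : 0 <= j by rewrite fine_ge0.
(* With [del = 2 * B / nu], [k / nu] is [kappa * del], and [C / nu] will dominate the sum of all the
   other errors. Neither [k] nor [C] depends on [nu]. *)
pose k := 2 * kappa * B.
have k0 : 0 <= k by rewrite /k !mulr_ge0.
pose C := M * (2 * B + B / sg * (T - t)) + 2 * B * (A * B + Gam).
have Bsg0 : 0 <= B / sg by rewrite divr_ge0// ltW.
have C0 : 0 <= C.
  have TT : 0 <= T - t by rewrite subr_ge0.
  have B2 : 0 <= 2 * B by rewrite mulr_ge0.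
  have AB : 0 <= A * B by rewrite mulr_ge0.
  have BT : 0 <= B / sg * (T - t) by rewrite mulr_ge0.
  by apply: addr_ge0; apply: mulr_ge0 => //; exact: addr_ge0.
pose last_term := (C + 2 * k * (j + C)) / eta.
have lt0 : 0 <= last_term.
  have jC : 0 <= j + C by exact: addr_ge0.
  have k2 : 0 <= 2 * k by rewrite mulr_ge0.
  by apply: divr_ge0; [apply: addr_ge0 => //; exact: mulr_ge0|exact: ltW].
have Bdel0 : 0 <= B / del0 by rewrite divr_ge0// ltW.
(* The bound with [sg] allows the correction on the sublevel set, the one with [del0] keeps the time
   shift within the range of Condition (S), and the last two let the error be absorbed in [eta]. *)
have [nu [nu2 cnu nu_sg nu_del [nu_k nu_last]]] : exists nu : R,
    [/\ 2 <= nu, c < nu, 2 * (B / sg) <= nu, 2 * (B / del0) <= nu &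
        2 * k <= nu /\ last_term <= nu].
  by apply: exists_large => //; rewrite mulr_ge0.
have nu0 : 0 < nu by exact: lt_le_trans nu2.
have Bnu : B / nu <= sg / 2.
  rewrite ler_pdivrMr// -ler_pdivrMl ?divr_gt0// invf_div.
  have -> : 2 / sg * B = 2 * (B / sg) by ring.
  by [].

(* The time change *)
have [ep [ep0 ep2 epB]] := weight nu cnu Bnu.
set q := (fun x => _); move=> [iq q_ge qD qint qnorm].
pose del := 2 * B / nu.
have del_ge0 : 0 <= del by rewrite /del divr_ge0 ?mulr_ge0// ltW.
have del_le : del <= del0.
  rewrite /del ler_pdivrMr// -ler_pdivrMl//.
  have -> : del0^-1 * (2 * B) = 2 * (B / del0) by ring.
  by [].
have qD' (s : R) : s \notin `[t, T] -> q s = 0.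
  by move=> sD; apply: qD; exact/negP.
have [phi [psi [phiK psiK phi_mono phi_prim [phi_t phi_T phi_near]]]] :=
  reparametrization iq q_ge qD' tT qint.
pose p (s : lebesgueR R) := 1 + q s.
have mp : measurable_fun setT p.
  have mq : measurable_fun setT q.
    by apply/measurable_EFinP; exact: measurable_int iq.
  exact: (@measurable_funD _ (lebesgueR R) R setT (cst 1) q _ mq).
have p_half s : 2^-1 <= p s.
  by have := q_ge s; rewrite /p; move: (q s) => a; clear; lra.
have p0 s : 0 < p s by apply: lt_le_trans (p_half s); rewrite invr_gt0.
(* The maximum is at least 1 and at most 1/2 is subtracted from it, so [p] is at least half of it.
   This yields the bound [2 * nu] on the new control. *)
have pN s : N s <= 2 * nu * p s.
  have hmax : N s / nu <= Num.max 1 (N s / nu) by rewrite le_max lexx orbT.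
  have hmax1 : 1 <= Num.max 1 (N s / nu) by rewrite le_max lexx.
  have hind : ep * \1_(D `&` [set x0 | N x0 <= c]) s <= 2^-1.
    rewrite indicE; case: (_ \in _); rewrite ?mulr1 ?mulr0//.
  have hp : N s / nu <= 2 * p s.
    rewrite /p /q; move: hmax hmax1 hind.
    move: (N s / nu) (Num.max _ _) (ep * _) => a1 a2 a3; clear; lra.
  by move: hp; rewrite ler_pdivrMr// mulrAC.
have phiD s : (phi s \in `[t, T]) = (s \in `[t, T]).
  exact: phi_itv phi_mono phi_t phi_T s.
have psiD s : (psi s \in `[t, T]) = (s \in `[t, T]).
  exact: psi_itv psiK phi_mono phi_t phi_T s.
have psiT : psi T = T by exact: psi_T phiK phi_T.
have psit : psi t = t by exact: psi_t phiK phi_t.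
have preD : phi @^-1` D = D by exact: preimage_phi_D phi_mono phi_t phi_T.
have aepsi := ae_psi phiK psiK phi_mono mp p0 phi_prim.
have aephi := ae_phi phiK psiK phi_mono mp p0 phi_prim.

(* Admissibility and regularity of the new pair *)
pose z := y \o psi.
pose w (s : R) : 'cV[R]_m := (p (psi s))^-1 *: u (psi s).
have zv := W11_time_change yv phiK psiK phi_mono mp p0 phi_prim phi_t phi_T.
have mpD : measurable_fun D (fun s : lebesgueR R => (p s)^-1).
  by apply: measurable_inv_gt0 => //; exact: measurable_funTS.
pose w0 (s : R) : 'cV[R]_m := (p s)^-1 *: u s.
have mw0 : @measurable_fun _ _ (lebesgueR R) (borelType 'cV[R]_m) D w0.
  apply: (@measurable_fun_cV _ (lebesgueR R) R m D _ mD) => i.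
  apply: (@eq_measurable_fun _ _ (lebesgueR R) R D
    (fun s => (p s)^-1 * u s i ord0)); first by move=> s _; rewrite mxE.
  exact: (@measurable_funM _ (lebesgueR R) R D _ _ mpD
    (@measurable_fun_cV_coord _ (lebesgueR R) R m D u i mu)).
have mw : @measurable_fun _ _ (lebesgueR R) (borelType 'cV[R]_m) D w.
  exact: (measurable_fun_comp_psi phiK psiK phi_mono mp p0 phi_prim phi_t phi_T
    mw0).
have wb s : s \in `[t, T] -> `|w s| <= 2 * nu.
  move=> sD; rewrite normrZ gtr0_norm ?invr_gt0// mulrC ler_pdivrMr//.
  by rewrite -ND ?pN// /D/= psiD.
have zb s : s \in `[t, T] -> `|z s| <= Ymax.
  by move=> sD; apply: Yb; rewrite psiD.
have zvb : {ae leb, forall s : lebesgueR R, s \in `[t, T] ->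
    (p (psi s))^-1 *: v (psi s) = b (z s) *m w s}.
  apply: filterS (aepsi _ vb) => s h sD.
  by rewrite h ?psiD// /w scalemxAr.
have Uw : {ae leb, forall s : lebesgueR R, s \in `[t, T] -> U (w s)}.
  apply: filterS (aepsi _ Uu) => s h sD.
  by apply: U_cone; [apply: h; rewrite psiD|rewrite invr_gt0].
have Sz s : s \in `[t, T] -> S (z s) by move=> sD; apply: Sy; rewrite psiD.
have ctrl : control_pair T b S U t x z w.
  split => //; first by exists (fun s => (p (psi s))^-1 *: v (psi s)).
  by rewrite /z/= psit.
have zlip : [lipschitz z s | s in `[t, T]].
  have [theta theta0 bg] := b_growth.
  (* The constant combines the growth of [b], the bound [Ymax] on the trajectory and the bound
     [2 * nu] on the control. *)
  apply: (W11_lipschitz zv (c := theta * (1 + Ymax) * (2 * nu))).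
    by rewrite !mulr_ge0// ?addr_ge0// ltW.
  apply: filterS zvb => s h sD; rewrite h//; apply: (le_trans (bg _ _)).
  by rewrite ler_pM ?mulr_ge0 ?addr_ge0 ?ler_wpM2l ?lerD2l ?wb ?zb.
have wbd : [bounded w s | s in `[t, T]].
  exists (2 * nu); split; first exact: num_real.
  by move=> r nur s sD; apply: (le_trans (wb s sD)); exact: ltW.

(* Comparison of the costs *)
pose F (s : lebesgueR R) := Lambda s (z s) (w s).
have mF : measurable_fun D F.
  by apply: running_cost_measurable => //; exact: W11_measurable zv.
have F0 s : D s -> 0 <= F s by move=> sD; apply: Lambda_ge0; exact: D0T.
have mFphi : measurable_fun D (F \o phi).
  have mphi := lebesgue_measurable_phi phiK psiK phi_mono mp p0 phi_prim.
  have sub : phi @` D `<=` D by move=> _ [s sD <-]; rewrite /D/= phiD.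
  exact: (measurable_comp mD sub mF (measurable_funTS mphi)).
have intF : (\int[leb]_(s in D) (F s)%:E =
    \int[leb]_(s in D) (F (phi s) * p s)%:E)%E.
  rewrite (ge0_integral_change phiK psiK phi_mono mp p0 phi_prim mD).
  - by rewrite preD; apply: eq_integral => s _; rewrite EFinM.
  - exact/measurable_EFinP.
  - by move=> s sD; rewrite lee_fin F0.
have kdel : kappa * del = k / nu by rewrite /del /k; ring.
have kdel2 : k / nu <= 2^-1.
  by rewrite ler_pdivrMr// mulrC ler_pdivlMr// mulrC.
have near_del s : `|phi s - s| <= del.
  by apply: (le_trans (phi_near s)); exact: qnorm.
have pE s : s \in `[t, T] ->
    p s = Num.max 1 (`|u s| / nu) - ep * (`|u s| <= c)%R%:R.
  move=> sD; rewrite /p /q ND//.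
  have -> : \1_(D `&` [set x | N x <= c]) s = (`|u s| <= c)%R%:R :> R.
    rewrite indicE; congr (_%:R); congr nat_of_bool; apply/idP/idP.
      by rewrite inE => -[_ /=]; rewrite ND.
    by move=> uc; rewrite inE; split => //=; rewrite ND.
  by ring.
have FphiE s : F (phi s) = Lambda (phi s) (y s) ((p s)^-1 *: u s).
  by rewrite /F /w /z/= phiK.
have Hle : {ae leb, forall s : lebesgueR R, s \in `[t, T] ->
    (1 - k / nu) * (F (phi s) * p s) <=
    G s + M * (2 * N s / nu + ep) + del * (A * N s + `|gamma (phi s)| * p s)}.
  (* Condition (S) is used at [phi s] rather than at [s]: [gamma (phi s) * p s]
     is integrable, while [gamma s * p s] need not be. *)
  apply: filterS3 (aephi _ condS) Uu Lambda_convex => s hS hU hC sD.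
  have uU := hU sD.
  have wU : U ((p s)^-1 *: u s) by apply: U_cone; rewrite ?invr_gt0.
  have sph : phi s \in `[t, T] by rewrite phiD.
  have nd := le_trans (near_del s) del_le.
  have hS' : `|Lambda (phi s) (y s) ((p s)^-1 *: u s)
             - Lambda s (y s) ((p s)^-1 *: u s)|
    <= (kappa * Lambda (phi s) (y s) ((p s)^-1 *: u s)
        + A * `|(p s)^-1 *: u s| + gamma (phi s)) * `|phi s - s|.
    apply: hS => //; try exact: D0T.
      by rewrite in_itv/= -ler_distlC.
    by rewrite in_itv/= lerDl gerBl ltW.
  have resc : Lambda s (y s) ((p s)^-1 *: u s) * p s <=
      G s + M * (2 * N s / nu + ep).
    rewrite ND//.
    apply: (rescaled_value_le nu2 c0 cnu ep0 ep2 _ _ _ (pE s sD)).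
    - by move=> w'; apply: Lambda_ge0; exact: D0T.
    - by move=> w' hw'; apply: LM => //; [exact: D0T|exact: Yb].
    - by apply: hC => //; exact: D0T.
  rewrite FphiE -kdel.
  apply: (shifted_cost_le hS' _ (near_del s) resc) => //.
  - by rewrite normrZ gtr0_norm ?invr_gt0// mulrAC mulVf ?mul1r ?ND// gt_eqF.
  - by apply: Lambda_ge0; exact: D0T.
have kn_ge0 : 0 <= 1 - k / nu.
  by move: kdel2; move: (k / nu) => r; clear; lra.
pose c1 := M * 2 / nu + del * A.
have c1_ge0 : 0 <= c1.
  by apply: addr_ge0; [apply: divr_ge0; [exact: mulr_ge0|exact: ltW]|
    exact: mulr_ge0].
have mpD' : measurable_fun D p by exact: measurable_funTS.
have mg : measurable_fun D (fun s : lebesgueR R => `|gamma s|).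
  by apply/measurable_EFinP; exact: measurable_int igD.
have mgphi : measurable_fun D (fun s : lebesgueR R => `|gamma (phi s)|).
  have mphi := lebesgue_measurable_phi phiK psiK phi_mono mp p0 phi_prim.
  have sub : phi @` D `<=` D by move=> _ [s sD <-]; rewrite /D/= phiD.
  exact: (measurable_comp mD sub mg (measurable_funTS mphi)).
pose W (s : lebesgueR R) := `|gamma (phi s)| * p s.
have mW : measurable_fun D W.
  exact: (@measurable_funM _ (lebesgueR R) R D _ _ mgphi mpD').
pose H (s : lebesgueR R) := F (phi s) * p s.
have mH : measurable_fun D H.
  exact: (@measurable_funM _ (lebesgueR R) R D _ _ mFphi mpD').
have H0 s : D s -> 0 <= H s.
  by move=> sD; apply: mulr_ge0; [apply: F0; rewrite /D/= phiD|exact: ltW].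
have W0 s : D s -> 0 <= W s by move=> _; apply: mulr_ge0 => //; exact: ltW.
(* Undoing the substitution gives the integral of [|gamma|], a bound independent of [nu]. *)
have intW : (\int[leb]_(s in D) (W s)%:E = Gam%:E)%E.
  rewrite /Gam /Rintegral fineK; last exact: integrable_fin_num.
  rewrite [RHS](ge0_integral_change phiK psiK phi_mono mp p0 phi_prim mD).
  - by rewrite preD; apply: eq_integral => s _; rewrite EFinM.
  - exact/measurable_EFinP.
  - by move=> s _; rewrite lee_fin.
have HK : {ae leb, forall s, D s ->
    (1 - k / nu) * H s <= G s + (c1 * N s + M * ep) + del * W s}.
  apply: filterS Hle => s Hs sD; apply: (le_trans (Hs sD)).
  rewrite le_eqVlt; apply/orP; left; apply/eqP.
  by rewrite /c1 /W; ring.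
have Mep0 : 0 <= M * ep by exact: mulr_ge0.
have main := integral_error_le mD lD mG mH mW iN G0 H0 N0 W0 kn_ge0 c1_ge0
  Mep0 del_ge0 HK.
rewrite -intF jE intW -/B -EFinM -!EFinD in main.
have JF0 : (0 <= \int[leb]_(s in D) (F s)%:E)%E.
  by apply: integral_ge0 => s sD; rewrite lee_fin F0.
have kn_half : 0 < 1 - k / nu.
  by move: kdel2; move: (k / nu) => r; clear; lra.
(* The right-hand side of [main] is finite and the factor [1 - k / nu] is positive, so the new
   running cost cannot be infinite. *)
have Ffin : (\int[leb]_(s in D) (F s)%:E)%E \is a fin_num.
  rewrite ge0_fin_numE// ltNge leye_eq; apply/negP => /eqP Foo.
  by move: main; rewrite Foo gt0_muley ?lte_fin// leye_eq.
rewrite -(fineK Ffin) -EFinM lee_fin in main.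
(* The bound [ep <= B / sg / nu] makes the error on the sublevel set of order [1 / nu] as well. *)
have err : j + (c1 * B + M * ep * (T - t)) + del * Gam <= j + C / nu.
  have h : M * ep * (T - t) <= M * (B / sg / nu) * (T - t).
    by apply: ler_wpM2r; [rewrite subr_ge0|exact: ler_wpM2l].
  have -> : C / nu = c1 * B + M * (B / sg / nu) * (T - t) + del * Gam.
    by rewrite /C /c1 /del; ring.
  by rewrite -addrA lerD2l lerD2r lerD2l.
have nu1 : 1 <= nu by apply: le_trans nu2; rewrite ler1n.
have Feta : (\int[leb]_(s in D) (F s)%:E <=
    \int[leb]_(s in D) (G s)%:E + eta%:E)%E.
  rewrite -(fineK Ffin) jE -EFinD lee_fin.
  exact: (absorb_error j0 C0 k0 eta0 nu1 nu_k nu_last (le_trans main err)).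
(* As [psi] fixes [T], the terminal cost is unchanged. *)
have costE : cost T Lambda g t z w =
    (\int[leb]_(s in D) (F s)%:E + g (y T))%E.
  by rewrite /cost /z/= psiT.
have cost_le : (cost T Lambda g t z w <= cost T Lambda g t y u + eta%:E)%E.
  rewrite costE; apply: (le_trans (leeD2r (g (y T)) Feta)).
  have -> : cost T Lambda g t y u =
    (\int[leb]_(s in D) (G s)%:E + g (y T))%E by [].
  by rewrite (addeAC _ (g (y T))).
exists z, w; split => //; split => //.
by apply: (le_lt_trans cost_le); rewrite lte_add_pinfty// ltry.
Qed.

(** * Equality of the two infima *)

Theorem corollary5p9 (R : realType) (n m : nat) (hn : (1 <= n)%N)
    (hm : (1 <= m)%N) (T : R) (hT : 0 < T)
    (Lambda : R -> 'cV[R]_n -> 'cV[R]_m -> R)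
    (b : 'cV[R]_n -> 'M[R]_(n, m))
    (S : set 'cV[R]_n) (U : set 'cV[R]_m) (g : 'cV[R]_n -> \bar R)
    (Lambda_ge0 : forall s y u, s \in `[0, T] -> 0 <= Lambda s y u)
    (Lambda_meas : Lebesgue_Borel_measurable T Lambda)
    (b_Borel : Borel_map b)
    (b_growth : linear_growth b)
    (S_neq0 : S !=set0)
    (U_neq0 : U !=set0)
    (U_cone : cone U)
    (g_ge0 : forall x, S x -> (0 <= g x)%E)
    (g_proper : exists2 x, S x & g x != +oo%E)
    (Lambda_coercive : coercive T Lambda U)
    (exists_admissible : forall t x, t \in `[0, T[ -> S x ->
       exists y u, admissible T Lambda b S U g t x y u)
    (Lambda_bounded : bounded_on_bounded_sets T Lambda)
    (Lambda_S : condition_S T Lambda U)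
    (Lambda_convex : radially_convex T Lambda U) :
  forall t x, t \in `[0, T[ -> S x ->
    ereal_inf [set cost T Lambda g t yu.1 yu.2 | yu in
      [set yu : (R -> 'cV[R]_n) * (R -> 'cV[R]_m) |
         admissible T Lambda b S U g t x yu.1 yu.2]]
    = ereal_inf [set cost T Lambda g t yu.1 yu.2 | yu in
      [set yu : (R -> 'cV[R]_n) * (R -> 'cV[R]_m) |
         [/\ admissible T Lambda b S U g t x yu.1 yu.2,
             [lipschitz yu.1 s | s in `[t, T]] &
             [bounded yu.2 s | s in `[t, T]]]]].
Proof.
move=> t x tT Sx; apply/eqP; rewrite eq_le; apply/andP; split.
  by apply: ereal_inf_le_tmp => _ [yu [adm _ _] <-]; exists yu.
apply: le_ereal_inf_tmp => _ [[y u] /= adm <-].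
(* It suffices to bound the restricted infimum by the cost of the given pair plus an arbitrary
   [eta > 0]. *)
apply/lee_addgt0Pr => eta eta0.
have [z [w [zw_adm zlip wbd cost_le]]] := lipschitz_approximation Lambda_ge0
  Lambda_meas b_growth U_cone g_ge0 Lambda_coercive Lambda_bounded Lambda_S
  Lambda_convex tT adm eta0.
apply: le_trans cost_le; apply: ereal_inf_lbound.
by exists (z, w).
Qed.
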